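(* Let $H\le F$ be a subgroup of Thompson's group $F$. Then the closure $\mathrm{Cl}(H)$ is the subgroup of $F$ consisting of piecewise-linear functions $f$, with finitely many pieces, such that each piece has dyadic endpoints and such that on each piece $f$ coincides with a restriction of some function from $H$.
   Context: Thompson's group $F$ is the group of all piecewise-linear increasing homeomorphisms of $[0,1]$ with finitely many breakpoints, all in $\mathbb{Z}[\frac12]\cap(0,1)$, and all slopes integer powers of $2$. Dyadic means in $\mathbb{Z}[\frac12]$. Diagrams. For a finite binary word $u$, $[u]$ is the dyadic interval $[.u,.u1^{\mathbb N}]$ (binary expansions). Each $f\in F$ has a unique reduced pair $(T_+,T_-)$ of finite rooted full binary trees with the same number $n$ of leaves such that, if $u_1,\dots,u_n$ and $v_1,\dots,v_n$ are the leaf addresses ($0$ = left, $1$ = right) from left to right of $T_+$ and $T_-$, then $f$ maps $[u_i]$ linearly onto $[v_i]$ for all $i$ (reduced: for no $i$ are leaves $i,i+1$ the two children of one node in both trees). The reduced diagram $\Delta$ of $f$ is the following directed $2$-complex. Its edges are the nodes of $T_+$ and of $T_-$, the $i$-th leaf of $T_+$ being identified with the $i$-th leaf of $T_-$. It has vertices $0,\dots,n$, and a node whose descendant leaves are the $i$-th through $j$-th is an edge directed from vertex $i-1$ to vertex $j$. For each non-leaf node $e$ of either tree there is a positive cell with top edge $e$, left bottom edge the left child of $e$ and right bottom edge the right child of $e$ (together with its formal inverse, a negative cell). The top edge of $\Delta$ is the root of $T_+$, the bottom edge of $\Delta$ is the root of $T_-$. (For the identity, $\Delta$ is a single edge.)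 Core. Let $H\le F$ be generated by elements with reduced diagrams $\Delta_i$, $i\in\mathcal I$. Identify all top edges and all bottom edges of all $\Delta_i$ into one distinguished edge $p$ (with corresponding identification of endpoints). Then apply foldings as long as possible: whenever two positive cells have the same top edge, identify their left bottom edges, their right bottom edges and the cells; whenever two positive cells have the same left bottom edge and the same right bottom edge, identify their top edges and the cells (identifying edges also identifies their initial vertices and their terminal vertices). The resulting complex (a limit if infinitely many foldings are needed) with distinguished edge $p$ is the core $\mathcal L(H)$; it does not depend on the generating set or on the order of foldings. Closure. $\mathcal L(H)$ accepts a diagram $\Delta$ if there is a map from $\Delta$ to $\mathcal L(H)$ taking vertices to vertices, edges to edges, positive cells to positive cells, preserving initial and terminal vertices of edges and top, left bottom and right bottom edges of cells, and sending both the top and the bottom edge of $\Delta$ to $p$. The closure $\mathrm{Cl}(H)$ is the subgroup of all $f\in F$ whose reduced diagram is accepted by $\mathcal L(H)$. *)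

(* Defs.v *)
From HB Require Import structures.
From mathcomp Require Import all_boot all_order all_algebra.
From mathcomp Require Import generic_quotient.
From mathcomp Require Import all_classical all_reals all_analysis.
From Stdlib Require Import Relation_Operators.
Import Order.TTheory GRing.Theory Num.Theory.
Import numFieldNormedType.Exports.

Set Implicit Arguments.
Unset Strict Implicit.
Unset Printing Implicit Defensive.

Local Open Scope classical_set_scope.
Local Open Scope ring_scope.

(* The unit interval, with the topology induced from [R]. *)
Definition I01 (R : realType) : Type := set_type `[0 : R, 1 : R]%classic.
HB.instance Definition _ (R : realType) := Topological.on (I01 R).

Definition pt (R : realType) (x : I01 R) : R := set_val x.

Section ThompsonF.
Variable R : realType.
Implicit Types (f g h : I01 R -> I01 R) (J K : set R) (s : seq R).

Definition dyadic (x : R) : Prop :=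
  exists (m : int) (k : nat), x = m%:~R / 2 ^+ k.

Definition affine_on J f (a b : R) : Prop :=
  forall x : I01 R, J (pt x) -> pt (f x) = a * pt x + b.

(* A partition 0 < s_0 < ... < s_(m-1) = 1 whose m closed pieces have dyadic
   endpoints. *)
Definition dyadic_partition s : Prop :=
  itv_partition 0 1 s /\ forall x, x \in s -> dyadic x.

Definition piece s (i : nat) : set R := `[nth 1 (0 :: s) i, nth 1 s i].

Definition homeomorphism f : Prop :=
  exists g, [/\ cancel f g, cancel g f, continuous f & continuous g].

Definition thompsonF : set (I01 R -> I01 R) := [set f |
  [/\ homeomorphism f,
      {homo f : x y / pt x < pt y} &
      exists2 s, dyadic_partition s &
        forall i, (i < size s)%N ->
          exists (k : int) (b : R), affine_on (piece s i) f (2 ^ k) b]].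

Definition subgroupF (H : set (I01 R -> I01 R)) : Prop :=
  [/\ H `<=` thompsonF,
      H id,
      forall f g, H f -> H g -> H (f \o g) &
      forall f g, H f -> cancel f g -> cancel g f -> H g].

(* Binary words are sequences of booleans: [false] is 0 (left), [true] is 1
   (right). [word_val u] is the number .u, and since .u1^N = .u + 2^-|u|,
   [word_itv u] is the interval [u]. *)
Definition word_val (u : seq bool) : R :=
  \sum_(i < size u) (nth false u i)%:R / 2 ^+ i.+1.

Definition word_itv (u : seq bool) : set R :=
  `[word_val u, word_val u + 2 ^- size u].

Definition maps_linearly_onto f J K : Prop :=
  f @` [set x | J (pt x)] = [set y | K (pt y)] /\
  exists a b, affine_on J f a b.

End ThompsonF.

Inductive tree := Leaf | Node (l r : tree).

Fixpoint leaves (t : tree) : seq (seq bool) :=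
  match t with
  | Leaf => [:: [::]]
  | Node l r => map (cons false) (leaves l) ++ map (cons true) (leaves r)
  end.

Fixpoint subtree (t : tree) (u : seq bool) {struct u} : option tree :=
  match u, t with
  | [::], _ => Some t
  | b :: u', Node l r => subtree (if b then r else l) u'
  | _ :: _, Leaf => None
  end.

Definition is_node (t : tree) (u : seq bool) : bool := isSome (subtree t u).

Definition is_inner (t : tree) (u : seq bool) : bool :=
  if subtree t u is Some (Node _ _) then true else false.

Definition node (t : tree) := {u : seq bool | is_node t u}.
Definition inner (t : tree) := {u : seq bool | is_inner t u}.

Lemma is_inner_node t u : is_inner t u -> is_node t u.
Proof. by rewrite /is_inner /is_node; case: subtree. Qed.

Lemma is_node_child t u b : is_inner t u -> is_node t (rcons u b).
Proof.
rewrite /is_inner /is_node.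
by elim: u t => [|c u IH] [|l r] //=; exact: IH.
Qed.

Definition root (t : tree) : node t := exist _ [::] isT.
Definition inner_node t (u : inner t) : node t :=
  exist _ (sval u) (is_inner_node (svalP u)).
Definition child t (b : bool) (u : inner t) : node t :=
  exist _ (rcons (sval u) b) (is_node_child b (svalP u)).

(* The numbers of leaves of [t] strictly to the left of the node [u], and below
   the node [u]. *)
Fixpoint leaves_before (t : tree) (u : seq bool) {struct u} : nat :=
  match u, t with
  | b :: u', Node l r =>
      if b then (size (leaves l) + leaves_before r u')%N else leaves_before l u'
  | _, _ => 0%N
  end.

Definition leaves_below (t : tree) (u : seq bool) : nat :=
  if subtree t u is Some t' then size (leaves t') else 0%N.

Record tree_pair := TreePair {
  tplus : tree;
  tminus : tree;
  tpE : size (leaves tplus) = size (leaves tminus) }.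

Definition nleaves (D : tree_pair) : nat := size (leaves (tplus D)).

Definition leaf_addr (t : tree) (i : nat) : seq bool := nth [::] (leaves t) i.

Definition siblings (t : tree) (i : nat) : Prop :=
  exists w, leaf_addr t i = rcons w false /\ leaf_addr t i.+1 = rcons w true.

Definition reduced (D : tree_pair) : Prop :=
  forall i, (i.+1 < nleaves D)%N ->
    ~ (siblings (tplus D) i /\ siblings (tminus D) i).

Definition reduced_pair_of (R : realType) (f : I01 R -> I01 R) (D : tree_pair)
    : Prop :=
  reduced D /\
  forall i, (i < nleaves D)%N ->
    maps_linearly_onto f (word_itv (leaf_addr (tplus D) i))
                         (word_itv (leaf_addr (tminus D) i)).

(* Only positive cells are recorded: negative cells are their formal inverses
   and carry no further information. *)
Record complex := Complex {
  vertex : Type;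
  edge : Type;
  cell : Type;
  ini : edge -> vertex;
  ter : edge -> vertex;
  top : cell -> edge;
  lbot : cell -> edge;
  rbot : cell -> edge }.

Record complex_map (K L : complex) := ComplexMap {
  vmap : vertex K -> vertex L;
  emap : edge K -> edge L;
  cmap : cell K -> cell L;
  map_ini : forall e, ini (emap e) = vmap (ini e);
  map_ter : forall e, ter (emap e) = vmap (ter e);
  map_top : forall c, top (cmap c) = emap (top c);
  map_lbot : forall c, lbot (cmap c) = emap (lbot c);
  map_rbot : forall c, rbot (cmap c) = emap (rbot c) }.

(* Quotient of a type by the equivalence relation generated by [r]. *)
Section Quotient.
Local Open Scope quotient_scope.
Variables (T : Type) (r : T -> T -> Prop).

Definition eqv : rel {classic T} :=
  fun x y => `[< clos_refl_sym_trans T r x y >].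

Lemma eqv_refl : reflexive eqv.
Proof. by move=> x; apply/asboolP; exact: rst_refl. Qed.

Lemma eqv_sym : symmetric eqv.
Proof. by move=> x y; apply/asboolP/asboolP => ?; exact: rst_sym. Qed.

Lemma eqv_trans : transitive eqv.
Proof.
by move=> y x z /asboolP xy /asboolP yz; apply/asboolP; exact: rst_trans yz.
Qed.

Canonical eqv_equiv := EquivRel eqv eqv_refl eqv_sym eqv_trans.

Definition quot : Type := {eq_quot eqv}.
Definition cls (x : T) : quot := \pi_({eq_quot eqv}) (x : {classic T}).
Definition rep (q : quot) : T := repr (q : {eq_quot eqv}).

Lemma repK q : cls (rep q) = q.
Proof. exact: reprK. Qed.

Lemma clsP x y : cls x = cls y <-> clos_refl_sym_trans T r x y.
Proof.
by split=> [/eqmodP/asboolP //|rxy]; apply/eqmodP/asboolP.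
Qed.

End Quotient.

Section DisjointUnion.
Variables (I : Type) (K : I -> complex).

Definition disjoint_union : complex :=
  @Complex {i : I & vertex (K i)} {i : I & edge (K i)} {i : I & cell (K i)}
    (fun e => existT _ (projT1 e) (ini (projT2 e)))
    (fun e => existT _ (projT1 e) (ter (projT2 e)))
    (fun c => existT _ (projT1 c) (top (projT2 c)))
    (fun c => existT _ (projT1 c) (lbot (projT2 c)))
    (fun c => existT _ (projT1 c) (rbot (projT2 c))).

End DisjointUnion.

Section Diagram.
Variable D : tree_pair.

Definition tp_edge : Type := (node (tplus D) + node (tminus D))%type.
Definition tp_cell : Type := (inner (tplus D) + inner (tminus D))%type.

Inductive leaf_glue : tp_edge -> tp_edge -> Prop :=
| LeafGlue (u : node (tplus D)) (v : node (tminus D)) (i : nat) :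
    (i < nleaves D)%N ->
    sval u = leaf_addr (tplus D) i -> sval v = leaf_addr (tminus D) i ->
    leaf_glue (inl u) (inr v).

Definition tp_ini (e : tp_edge) : 'I_(nleaves D).+1 :=
  match e with
  | inl u => inord (leaves_before (tplus D) (sval u))
  | inr v => inord (leaves_before (tminus D) (sval v))
  end.

Definition tp_ter (e : tp_edge) : 'I_(nleaves D).+1 :=
  match e with
  | inl u => inord (leaves_before (tplus D) (sval u) +
                    leaves_below (tplus D) (sval u))
  | inr v => inord (leaves_before (tminus D) (sval v) +
                    leaves_below (tminus D) (sval v))
  end.

Definition tp_top (c : tp_cell) : tp_edge :=
  match c with inl u => inl (inner_node u) | inr v => inr (inner_node v) end.

Definition tp_bot (b : bool) (c : tp_cell) : tp_edge :=
  match c with inl u => inl (child b u) | inr v => inr (child b v) end.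

Definition diagram : complex :=
  @Complex 'I_(nleaves D).+1 (quot leaf_glue) tp_cell
    (fun e => tp_ini (rep e))
    (fun e => tp_ter (rep e))
    (fun c => cls leaf_glue (tp_top c))
    (fun c => cls leaf_glue (tp_bot false c))
    (fun c => cls leaf_glue (tp_bot true c)).

Definition top_edge : edge diagram := cls leaf_glue (inl (root (tplus D))).
Definition bot_edge : edge diagram := cls leaf_glue (inr (root (tminus D))).

End Diagram.

(* [ini] and [ter] of a diagram do not depend on the representatives. *)
Lemma leaves_before_leaf t i : (i < size (leaves t))%N ->
  leaves_before t (leaf_addr t i) = i /\ subtree t (leaf_addr t i) = Some Leaf.
Proof.
rewrite /leaf_addr; elim: t i => [|l IHl r IHr] i /=; first by case: i.
rewrite size_cat !size_map nth_cat size_map => ilr.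
case: ltnP => il; first by rewrite (nth_map [::]) //=; exact: IHl.
have ir : (i - size (leaves l) < size (leaves r))%N by rewrite ltn_subLR.
rewrite (nth_map [::]) //=; have [-> ->] := IHr _ ir.
by rewrite subnKC.
Qed.

Lemma diagram_ini D (e : tp_edge D) :
  ini (cls (@leaf_glue D) e : edge (diagram D)) = tp_ini e.
Proof.
suff glueE x y : clos_refl_sym_trans _ (@leaf_glue D) x y ->
    tp_ini x = tp_ini y by apply/glueE/clsP; exact: repK.
elim=> {x y} [_ _ [u v i iD eu ev]|//|x y _ ->//|x y z _ -> _ ->//].
rewrite /= eu ev; congr inord.
by rewrite !(leaves_before_leaf _).1 // -(tpE D).
Qed.

Lemma diagram_ter D (e : tp_edge D) :
  ter (cls (@leaf_glue D) e : edge (diagram D)) = tp_ter e.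
Proof.
suff glueE x y : clos_refl_sym_trans _ (@leaf_glue D) x y ->
    tp_ter x = tp_ter y by apply/glueE/clsP; exact: repK.
elim=> {x y} [_ _ [u v i iD eu ev]|//|x y _ ->//|x y z _ -> _ ->//].
have iD' : (i < size (leaves (tminus D)))%N by rewrite -(tpE D).
rewrite /= eu ev /leaves_below; congr inord.
have [-> ->] := leaves_before_leaf iD.
by have [-> ->] := leaves_before_leaf iD'.
Qed.

(* The edges, cells and vertices of [K] that get identified, after finitely
   many steps, by first identifying edges along [r] and then folding as long as
   possible. Quotienting by all these identifications is the limit of the
   folding process. *)
Section Folding.
Variables (K : complex) (r : edge K -> edge K -> Prop).

Inductive fold_edge : edge K -> edge K -> Prop :=
| fold_edge_base e e' : r e e' -> fold_edge e e'
| fold_edge_refl e : fold_edge e e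
| fold_edge_sym e e' : fold_edge e e' -> fold_edge e' e
| fold_edge_trans e e' e'' :
    fold_edge e e' -> fold_edge e' e'' -> fold_edge e e''
| fold_edge_lbot c c' :
    fold_edge (top c) (top c') -> fold_edge (lbot c) (lbot c')
| fold_edge_rbot c c' :
    fold_edge (top c) (top c') -> fold_edge (rbot c) (rbot c')
| fold_edge_top c c' :
    fold_edge (lbot c) (lbot c') -> fold_edge (rbot c) (rbot c') ->
    fold_edge (top c) (top c').

Inductive fold_cell : cell K -> cell K -> Prop :=
| fold_cell_top c c' : fold_edge (top c) (top c') -> fold_cell c c'
| fold_cell_bot c c' :
    fold_edge (lbot c) (lbot c') -> fold_edge (rbot c) (rbot c') ->
    fold_cell c c'.

Inductive fold_vertex : vertex K -> vertex K -> Prop :=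
| fold_vertex_ini e e' : fold_edge e e' -> fold_vertex (ini e) (ini e')
| fold_vertex_ter e e' : fold_edge e e' -> fold_vertex (ter e) (ter e').

Definition folded : complex :=
  @Complex (quot fold_vertex) (quot fold_edge) (quot fold_cell)
    (fun e => cls fold_vertex (ini (rep e)))
    (fun e => cls fold_vertex (ter (rep e)))
    (fun c => cls fold_edge (top (rep c)))
    (fun c => cls fold_edge (lbot (rep c)))
    (fun c => cls fold_edge (rbot (rep c))).

Lemma clos_fold_edge e e' :
  clos_refl_sym_trans _ fold_edge e e' -> fold_edge e e'.
Proof.
elim=> // [x|x y _ /fold_edge_sym //|x y z _ xy _ yz].
  exact: fold_edge_refl.
exact: fold_edge_trans xy yz.
Qed.

Lemma clos_fold_cell c c' : clos_refl_sym_trans _ fold_cell c c' ->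
  [/\ fold_edge (top c) (top c'), fold_edge (lbot c) (lbot c') &
      fold_edge (rbot c) (rbot c')].
Proof.
elim=> [x y [{}x {}y xy|{}x {}y l r']|x|x y _ [? ? ?]|x y z _ [? ? ?] _ [? ? ?]].
- by split=> //; [exact: fold_edge_lbot|exact: fold_edge_rbot].
- by split=> //; exact: fold_edge_top.
- by split; exact: fold_edge_refl.
- by split; exact: fold_edge_sym.
- by split; apply: fold_edge_trans; eassumption.
Qed.

(* The structure maps of [folded] do not depend on the representatives. *)
Lemma folded_ini e : @ini folded (cls fold_edge e) = cls fold_vertex (ini e).
Proof.
apply/clsP/rst_step/fold_vertex_ini/clos_fold_edge.
by apply/clsP; rewrite repK.
Qed.

Lemma folded_ter e : @ter folded (cls fold_edge e) = cls fold_vertex (ter e).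
Proof.
apply/clsP/rst_step/fold_vertex_ter/clos_fold_edge.
by apply/clsP; rewrite repK.
Qed.

Lemma folded_cell c :
  [/\ @top folded (cls fold_cell c) = cls fold_edge (top c),
      @lbot folded (cls fold_cell c) = cls fold_edge (lbot c) &
      @rbot folded (cls fold_cell c) = cls fold_edge (rbot c)].
Proof.
have /clsP/clos_fold_cell[tE lE rE] := repK (cls fold_cell c).
by split; apply/clsP/rst_step.
Qed.

End Folding.

Section Core.
Variables (I : Type) (D : I -> tree_pair).

(* Besides the diagrams of the family there is the one-edge diagram of the
   identity, at index [None]: it provides the distinguished edge, also when the
   family is empty. *)
Definition id_pair : tree_pair := @TreePair Leaf Leaf erefl.
Definition core_pair (i : option I) : tree_pair := oapp D id_pair i.

Definition unfolded : complex :=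
  disjoint_union (fun i => diagram (core_pair i)).

Definition p0 : edge unfolded := existT _ None (top_edge id_pair).

Inductive end_glue : edge unfolded -> edge unfolded -> Prop :=
| end_glue_top i : end_glue (existT _ i (top_edge (core_pair i))) p0
| end_glue_bot i : end_glue (existT _ i (bot_edge (core_pair i))) p0.

Definition core : complex := folded end_glue.
Definition core_p : edge core := cls (fold_edge end_glue) p0.

Definition core_accepts (E : tree_pair) : Prop :=
  exists phi : complex_map (diagram E) core,
    emap phi (top_edge E) = core_p /\ emap phi (bot_edge E) = core_p.

(* The closure of the subgroup generated by elements whose reduced diagrams are
   the [D i]. *)
Definition closure_of (R : realType) : set (I01 R -> I01 R) := [set f |
  thompsonF f /\ exists2 E, reduced_pair_of f E & core_accepts E].

End Core.

Arguments closure_of {I} D R _.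

(* Main.v *)
Require Import Defs.
From mathcomp Require Import all_boot all_order all_algebra.
From mathcomp Require Import all_classical all_reals all_analysis.
From mathcomp Require Import ring lra zify.
From Stdlib Require Import Relation_Operators.
Import Order.TTheory GRing.Theory Num.Theory.
Set Implicit Arguments.
Unset Strict Implicit.
Unset Printing Implicit Defensive.
Local Open Scope classical_set_scope.
Local Open Scope ring_scope.

(** Everything is expressed by words: [maps_word f u v] says that f carries the
    dyadic interval [u] affinely onto [v], increasingly. A map of F does this for
    every sufficiently long u, and conversely ([thompsonF_word],
    [word_thompsonF]). Let u be H-related to v if some h in H carries [u] to [v].
    A map of F is piecewise in H if and only if every sufficiently long u is
    H-related to its image ([piecewise_word_local]); since being H-related is an
    equivalence compatible with appending letters, these maps form a group
    ([word_localF_subgroup]).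

    A map accepted by the core is piecewise in H. Two words are ultimately
    H-related if they become so after appending any sufficiently long word. This
    relation holds between corresponding leaf addresses of a generator, passes
    from words to their children, and passes back from both children to the
    parent. So it holds between the addresses of any two edges that are
    identified in the core ([fold_edge_ultimately]), and therefore between
    corresponding leaf addresses of any accepted diagram
    ([core_accepts_ultimately]).

    Conversely, read words in the core from the distinguished edge, going to the
    left or right bottom edge of the cell below the current edge; where there is
    no such cell the remaining letters are kept, so that reading is total. Say
    that f preserves reading if every sufficiently long word reads the same as
    its image. These maps form a group containing the generators, hence H; the
    second kind of folding extends the property to every word on which f is
    affine ([maps_word_read]). Therefore maps that are piecewise in H preserve
    reading too. For such an f take the two trees cut exactly where f and its
    inverse become affine ([minimal_pair]). Corresponding leaves read the same,
    and it remains to see that inner nodes can be read inside the core. This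
    holds because a map that preserves reading is affine on every interval whose
    word reaches a dead end of the core ([dead_maps_word]). The readings of the
    nodes then form a map from the diagram to the core ([read_accepts]). *)

(** * Binary words and dyadic intervals *)

Section WordPoints.
Variable R : realType.
Implicit Types (u v w : seq bool) (t x : R).

(** The increasing affine parametrization of [u] by [0, 1]. In this form it
    composes along concatenation of words. *)
Definition word_pt u t : R := foldr (fun (b : bool) y => (b%:R + y) / 2) t u.

Lemma word_pt_cat u w t : word_pt (u ++ w) t = word_pt u (word_pt w t).
Proof. exact: foldr_cat. Qed.

Lemma word_pt_rcons u b t : word_pt (rcons u b) t = word_pt u ((b%:R + t) / 2).
Proof. by rewrite -cats1 word_pt_cat. Qed.

Lemma word_ptE u t : word_pt u t = word_val R u + t / 2 ^+ size u.
Proof.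
rewrite /word_val; elim: u => [|b u IH] /=; first by rewrite big_ord0 add0r expr0 divr1.
rewrite IH big_ord_recl /= expr1 mulrDl mulrDl addrA; congr (_ + _ + _).
  rewrite mulr_suml; apply: eq_bigr => i _ /=.
  by rewrite /bump /= add1n [in RHS]exprSr invfM mulrA.
by rewrite exprSr invfM mulrA.
Qed.

Lemma word_pt01 u t : 0 <= t <= 1 -> 0 <= word_pt u t <= 1.
Proof. by elim: u => //= b u IH /IH; case: b => /=; lra. Qed.

Lemma word_pt_interior u t : 0 < t < 1 -> 0 < word_pt u t < 1.
Proof. by elim: u => //= b u IH /IH; case: b => /=; lra. Qed.

Lemma word_pt_inj u : injective (word_pt u).
Proof. by elim: u => //= b u IH t t'; case: b => /= e; apply: IH; lra. Qed.

Lemma word_pt_lt u t t' : t < t' -> word_pt u t < word_pt u t'.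
Proof. by elim: u => //= b u IH /IH; case: b => /=; lra. Qed.

Lemma word_itvP u x :
  word_itv u x <-> exists2 t, 0 <= t <= 1 & x = word_pt u t.
Proof.
have p2 : 0 < 2 ^+ size u :> R by exact: exprn_gt0.
rewrite /word_itv /= in_itv /=; split=> [/andP[x0 x1]|[t t01 ->]].
  exists ((x - word_val R u) * 2 ^+ size u).
    apply/andP; split; first by rewrite mulr_ge0 ?subr_ge0 // ltW.
    by rewrite -ler_pdivlMr // div1r lerBlDl.
  by rewrite word_ptE mulfK ?lt0r_neq0 // addrC subrK.
case/andP: t01 => t0 t1; rewrite word_ptE lerDl divr_ge0 ?(ltW p2) //=.
by rewrite lerD2l ler_pdivrMr // mulVf ?lt0r_neq0.
Qed.

Lemma word_pt_numeral u :
  exists2 a, (a < 2 ^ size u)%N &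
    forall t, word_pt u t = (a%:R + t) / 2 ^+ size u.
Proof.
elim: u => [|b u [a au IH]] /=.
  by exists 0%N => // t; rewrite add0r divr1.
exists (b * 2 ^ size u + a)%N; first by rewrite expnS; case: b; lia.
move=> t; rewrite IH natrD natrM natrX exprS.
by field; rewrite expf_neq0.
Qed.

Lemma word_of_numeral n a : (a < 2 ^ n)%N ->
  exists2 u, size u = n & forall t, word_pt u t = (a%:R + t) / 2 ^+ n.
Proof.
elim: n a => [|n IH] a an.
  exists [::] => // t; have -> : a = 0%N by move: an; rewrite expn0; lia.
  by rewrite add0r divr1.
have [b [a' [a'n ->]]] :
    exists b : bool, exists a', (a' < 2 ^ n)%N /\ a = (b * 2 ^ n + a')%N.
  case: (ltnP a (2 ^ n)) => an'; first by exists false, a.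
  by exists true, (a - 2 ^ n)%N; move: an; rewrite expnS; lia.
have [u un uP] := IH _ a'n.
exists (b :: u) => /=; first by rewrite un.
move=> t; rewrite uP natrD natrM natrX exprS.
by field; rewrite expf_neq0.
Qed.

Lemma word_pt_cover n x : 0 <= x <= 1 ->
  exists u t, [/\ size u = n, 0 <= t <= 1 & x = word_pt u t].
Proof.
elim: n x => [|n IH] x x01; first by exists [::], x.
have [b y01] : exists b : bool, 0 <= 2 * x - b%:R <= 1.
  by case: (lerP x 2^-1) => h; [exists false|exists true] => /=; lra.
have [u [t [un t01 e]]] := IH _ y01.
by exists (b :: u), t; split; rewrite //= ?un // -e; lra.
Qed.

(** A point interior to [u] lies off the cuts between the words of length
    at most [size u], so it determines the first letters of every such word
    whose interval contains it. *)
Lemma word_pt_nested u v s t : (size v <= size u)%N -> 0 < s < 1 ->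
  0 <= t <= 1 -> word_pt u s = word_pt v t -> exists w, u = v ++ w.
Proof.
elim: v u => [|c v IH] [|b u] //=; first by exists [::].
  by exists (b :: u).
rewrite ltnS => uv s01 t01 e.
have := word_pt_interior u s01; have := word_pt01 v t01 => v01 u01.
have ebc : b = c.
  by case: b c e => -[] //= e; exfalso; lra.
rewrite ebc in e *; have [w ->] : exists w, u = v ++ w.
  by apply: IH => //; lra.
by exists w.
Qed.

Lemma word_pt_fix_nil w : word_pt w 0 = 0 -> word_pt w 1 = 1 -> w = [::].
Proof.
have t0 : 0 <= (0 : R) <= 1 by lra.
have t1 : 0 <= (1 : R) <= 1 by lra.
case: w => //= b w e0 e1; exfalso.
by move: (word_pt01 w t0) (word_pt01 w t1) e0 e1; case: b => /=; lra.
Qed.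

Lemma word_eq_ends u v : word_pt u 0 = word_pt v 0 ->
  word_pt u 1 = word_pt v 1 -> u = v.
Proof.
wlog uv : u v / (size v <= size u)%N => [hw|] e0 e1.
  by case/orP: (leq_total (size u) (size v)) => /hw; [symmetry|]; auto.
have [w uE] : exists w, u = v ++ w.
  pose t := (word_pt u 2^-1 - word_val R v) * 2 ^+ size v.
  have p2 : 0 < 2 ^+ size v :> R by exact: exprn_gt0.
  have tE : word_pt u 2^-1 = word_pt v t.
    by rewrite [RHS]word_ptE mulfK ?lt0r_neq0 // addrC subrK.
  have ut : word_pt u 0 < word_pt u 2^-1 < word_pt u 1.
    by rewrite !word_pt_lt //; lra.
  rewrite e0 e1 tE in ut.
  apply: (@word_pt_nested _ _ 2^-1 t) => //; first by lra.
  apply/andP; split; rewrite leNgt; apply/negP => /(word_pt_lt v); lra.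
rewrite uE !word_pt_cat in e0 e1.
by rewrite uE (word_pt_fix_nil (word_pt_inj e0) (word_pt_inj e1)) cats0.
Qed.

End WordPoints.

(** * Maps that are affine on a dyadic interval *)

Lemma finite_eventually (n : nat) (P : nat -> nat -> Prop) :
  (forall i, (i < n)%N -> exists k, forall m, (k <= m)%N -> P i m) ->
  exists k, forall m, (k <= m)%N -> forall i, (i < n)%N -> P i m.
Proof.
elim: n => [|n IH] Pn; first by exists 0%N.
have [k kP] := IH (fun i i_n => Pn i (ltnW i_n)).
have [k' k'P] := Pn n (leqnn _).
exists (maxn k k') => m; rewrite geq_max => /andP[km k'm] i.
rewrite ltnS leq_eqVlt => /orP[/eqP->|]; first exact: k'P.
exact: kP.
Qed.

(** There are finitely many words of a given length, so a bound for each of them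
    gives a common one. *)
Lemma finite_words_bound (k : nat) (P : seq bool -> nat -> Prop) :
  (forall u m n, (m <= n)%N -> P u m -> P u n) ->
  (forall u, size u = k -> exists m, P u m) ->
  exists m, forall u, size u = k -> P u m.
Proof.
elim: k P => [|k IH] P mono Pk.
  by have [m mP] := Pk [::] erefl; exists m => u /size0nil ->.
have Pcons b : exists m, forall u, size u = k -> P (b :: u) m.
  apply: (IH (fun u => P (b :: u))) => [u|u uk]; first exact: mono.
  by apply: Pk; rewrite /= uk.
have [[m0 m0P] [m1 m1P]] := (Pcons false, Pcons true).
exists (maxn m0 m1) => -[|b u] //= [uk].
case: b; [apply: (@mono _ m1)|apply: (@mono _ m0)]; rewrite ?leq_maxl ?leq_maxr //.
  exact: m1P.
exact: m0P.
Qed.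

Section MapsWord.
Variable R : realType.
Implicit Types (u v w : seq bool) (t : R) (x y : I01 R).
Implicit Types f g h : I01 R -> I01 R.

Lemma pt_bounds x : 0 <= pt x <= 1.
Proof. by have := set_valP x; rewrite /pt /= in_itv. Qed.

Lemma pt_inj : injective (@pt R).
Proof. by move=> x y; rewrite /pt set_valE => /val_inj. Qed.

Lemma pt_surj (a : R) : 0 <= a <= 1 -> exists x, pt x = a.
Proof.
move=> a01; have aP : a \in `[0 : R, 1 : R]%classic.
  by apply: mem_set; rewrite /= in_itv.
by exists (SigSub aP : set_type _).
Qed.

(** The local form of an element of F: [f] carries the canonical
    parametrization of [u] to that of [v]. *)
Definition maps_word f u v : Prop := forall x t,
  0 <= t <= 1 -> pt x = word_pt u t -> pt (f x) = word_pt v t.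

Lemma maps_word_id u : maps_word id u u.
Proof. by []. Qed.

Lemma maps_word_comp f g u v w :
  maps_word g u v -> maps_word f v w -> maps_word (f \o g) u w.
Proof. by move=> gv fw x t t01 xE; apply: fw => //; exact: gv. Qed.

Lemma maps_word_inv f g u v :
  cancel f g -> maps_word f u v -> maps_word g v u.
Proof.
move=> fK fv y t t01 yE.
have [x xE] := pt_surj (word_pt01 u t01).
by rewrite -xE; congr pt; rewrite -[x]fK; congr g; apply/pt_inj; rewrite (fv x t).
Qed.

Lemma maps_word_cat f u v w : maps_word f u v -> maps_word f (u ++ w) (v ++ w).
Proof.
move=> fv x t t01; rewrite !word_pt_cat; apply: fv; exact: word_pt01.
Qed.

Lemma maps_word_glue f u v :
  (forall b, maps_word f (rcons u b) (rcons v b)) -> maps_word f u v.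
Proof.
move=> fb x t t01 xE; case: (lerP t 2^-1) => t2.
  have tE : (false%:R + 2 * t) / 2 = t by rewrite /=; lra.
  by have := fb false x (2 * t); rewrite !word_pt_rcons tE; apply=> //; lra.
have tE : (true%:R + (2 * t - 1)) / 2 = t by rewrite /=; lra.
by have := fb true x (2 * t - 1); rewrite !word_pt_rcons tE; apply=> //; lra.
Qed.

Lemma maps_word_inj f u v v' : maps_word f u v -> maps_word f u v' -> v = v'.
Proof.
move=> fv fv'; apply: (@word_eq_ends R).
  have t01 : 0 <= (0 : R) <= 1 by lra.
  have [x xE] := pt_surj (word_pt01 u t01).
  by rewrite -(fv _ _ t01 xE) (fv' _ _ t01 xE).
have t01 : 0 <= (1 : R) <= 1 by lra.
have [x xE] := pt_surj (word_pt01 u t01).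
by rewrite -(fv _ _ t01 xE) (fv' _ _ t01 xE).
Qed.

Lemma maps_word_eq f g u v x : maps_word f u v -> maps_word g u v ->
  word_itv u (pt x) -> f x = g x.
Proof.
move=> fv gv /word_itvP[t t01 xE]; apply: pt_inj.
by rewrite (fv _ _ t01 xE) (gv _ _ t01 xE).
Qed.

Lemma eq_maps_word f g u v : (forall x, word_itv u (pt x) -> f x = g x) ->
  maps_word g u v -> maps_word f u v.
Proof.
by move=> fg gv x t t01 xE; rewrite fg; [exact: gv|apply/word_itvP; exists t].
Qed.

Lemma expz_subn (m n : nat) :
  (2 : R) ^ (m%:Z - n%:Z) = 2 ^+ m / 2 ^+ n.
Proof. by rewrite expfzDr ?pnatr_eq0 // -invr_expz. Qed.

Lemma maps_word_affine f u v : maps_word f u v -> exists b : R,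
  affine_on (word_itv u) f (2 ^ ((size u)%:Z - (size v)%:Z)) b.
Proof.
move=> fv; exists (word_val R v - word_val R u * 2 ^+ size u / 2 ^+ size v).
move=> x /word_itvP[t t01 xE]; rewrite (fv _ _ t01 xE) xE !word_ptE expz_subn.
by field; rewrite !expf_neq0 ?pnatr_eq0.
Qed.

(** An increasing map carries endpoints to endpoints, and an affine map is
    determined by its values at the endpoints. *)
Lemma maps_linearly_onto_word f u v : {homo f : x y / pt x < pt y} ->
  maps_linearly_onto f (word_itv u) (word_itv v) -> maps_word f u v.
Proof.
move=> f_incr [fE [a [b fab]]].
have f_le x y : pt x <= pt y -> pt (f x) <= pt (f y).
  by rewrite le_eqVlt => /orP[/eqP/pt_inj->//|/f_incr/ltW].
have t0 : 0 <= (0 : R) <= 1 by lra.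
have t1 : 0 <= (1 : R) <= 1 by lra.
have word_le w t : 0 <= t <= 1 -> word_pt w 0 <= word_pt w t <= word_pt w 1.
  move=> t01; apply/andP; split.
    have [->|tn] := eqVneq t 0; rewrite // ltW //; apply: word_pt_lt; lra.
  have [->|tn] := eqVneq t 1; rewrite // ltW //; apply: word_pt_lt; lra.
have [x0 x0E] := pt_surj (word_pt01 u t0).
have [x1 x1E] := pt_surj (word_pt01 u t1).
have img x t : 0 <= t <= 1 -> pt x = word_pt u t -> word_itv v (pt (f x)).
  move=> t01 xE; have : (f @` [set x | word_itv u (pt x)]) (f x).
    by exists x => //; apply/word_itvP; exists t.
  by rewrite fE.
have preimg t : 0 <= t <= 1 -> exists x s, [/\ 0 <= s <= 1,
    pt x = word_pt u s & pt (f x) = word_pt v t].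
  move=> t01; have [y yE] := pt_surj (word_pt01 v t01).
  have : [set y | word_itv v (pt y)] y by apply/word_itvP; exists t.
  rewrite -fE => -[x /word_itvP[s s01 xE] fxy].
  by exists x, s; rewrite fxy.
have f0 : pt (f x0) = word_pt v 0.
  have /word_itvP[t t01 tE] := img _ _ t0 x0E.
  have [x [s [s01 xE fxE]]] := preimg _ t0.
  apply/eqP; rewrite eq_le -{1}fxE f_le ?xE ?x0E /=; last first.
    by case/andP: (word_le u s s01).
  by rewrite tE; case/andP: (word_le v t t01).
have f1 : pt (f x1) = word_pt v 1.
  have /word_itvP[t t01 tE] := img _ _ t1 x1E.
  have [x [s [s01 xE fxE]]] := preimg _ t1.
  apply/eqP; rewrite eq_le -{2}fxE f_le ?xE ?x1E ?andbT /=; last first.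
    by case/andP: (word_le u s s01).
  by rewrite tE; case/andP: (word_le v t t01).
have aff x t : 0 <= t <= 1 -> pt x = word_pt u t -> pt (f x) = a * pt x + b.
  by move=> t01 xE; apply: fab; apply/word_itvP; exists t.
rewrite (aff _ _ t0 x0E) x0E in f0; rewrite (aff _ _ t1 x1E) x1E in f1.
move=> x t t01 xE; rewrite (aff _ _ t01 xE) xE.
move: f0 f1; rewrite !word_ptE mul0r addr0 => f0 f1.
have -> : a * (word_val R u + t / 2 ^+ size u) + b =
  (1 - t) * (a * word_val R u + b)
  + t * (a * (word_val R u + 1 / 2 ^+ size u) + b) by ring.
by rewrite f0 f1; ring.
Qed.

Lemma maps_word_linearly_onto f u v :
  maps_word f u v -> maps_linearly_onto f (word_itv u) (word_itv v).
Proof.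
move=> fv; split; last first.
  by have [b fb] := maps_word_affine fv; eexists; exists b; exact: fb.
apply/seteqP; split=> [_ [x /word_itvP[t t01 xE] <-]|y /word_itvP[t t01 yE]].
  by apply/word_itvP; exists t => //; exact: fv.
have [x xE] := pt_surj (word_pt01 u t01).
exists x; first by apply/word_itvP; exists t.
by apply: pt_inj; rewrite yE; exact: fv.
Qed.

End MapsWord.

(** * Dyadic partitions and words of large length *)

Section Partitions.
Variable R : realType.
Implicit Types (u v w : seq bool) (s : seq R) (a b t : R) (x y : I01 R).
Implicit Types f g h : I01 R -> I01 R.

Definition uniform_partition n : seq R :=
  [seq (i.+1)%:R / 2 ^+ n | i <- iota 0 (2 ^ n)].

Lemma size_uniform_partition n : size (uniform_partition n) = (2 ^ n)%N.
Proof. by rewrite size_map size_iota. Qed.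

Lemma nth_uniform_partition n i : (i < 2 ^ n)%N ->
  nth 1 (uniform_partition n) i = i.+1%:R / 2 ^+ n.
Proof. by move=> i_n; rewrite (nth_map 0%N) ?size_iota // nth_iota. Qed.

Lemma nth_uniform_partition0 n i : (i <= 2 ^ n)%N ->
  nth 1 (0 :: uniform_partition n) i = i%:R / 2 ^+ n.
Proof. by case: i => [|i i_n]; rewrite ?mul0r //= nth_uniform_partition. Qed.

Lemma uniform_partition_dyadic n : dyadic_partition (uniform_partition n).
Proof.
have p2 : 0 < 2 ^+ n :> R by exact: exprn_gt0.
split; last first.
  by move=> _ /mapP[i _ ->]; exists i.+1%:Z, n.
split.
  apply/(pathP 1) => i; rewrite size_uniform_partition => i_n.
  rewrite nth_uniform_partition0 1?ltnW // nth_uniform_partition //.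
  by rewrite ltr_pM2r ?invr_gt0 // ltr_nat.
apply/eqP; rewrite (last_nth 1) size_uniform_partition nth_uniform_partition0 //.
by rewrite natrX divff // lt0r_neq0.
Qed.

Lemma uniform_partition_piece n i : (i < size (uniform_partition n))%N ->
  exists2 u, size u = n & piece (uniform_partition n) i = word_itv u.
Proof.
rewrite size_uniform_partition => i_n.
have [u un uE] := @word_of_numeral R _ _ i_n; exists u => //.
rewrite /piece /word_itv nth_uniform_partition0 1?ltnW // nth_uniform_partition //.
have -> : word_val R u = i%:R / 2 ^+ n.
  by have := uE 0; rewrite word_ptE mul0r !addr0.
by rewrite un -[i.+1%:R]natr1 mulrDl div1r.
Qed.

Lemma dyadic_num a : dyadic a ->
  exists k, forall n, (k <= n)%N -> exists m : int, a = m%:~R / 2 ^+ n.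
Proof.
move=> [m [k ->]]; exists k => n kn; exists (m * 2 ^+ (n - k)).
rewrite -{2}(subnK kn) exprD rmorphM rmorphXn /=.
by field; rewrite !expf_neq0.
Qed.

Lemma dyadicD a b : dyadic a -> dyadic b -> dyadic (a + b).
Proof.
move=> /dyadic_num[k ka] /dyadic_num[k' kb].
have [m ->] := ka _ (leq_maxl k k'); have [m' ->] := kb _ (leq_maxr k k').
by exists (m + m'), (maxn k k'); rewrite rmorphD mulrDl.
Qed.

Lemma dyadicN a : dyadic a -> dyadic (- a).
Proof. by move=> [m [k ->]]; exists (- m), k; rewrite rmorphN mulNr. Qed.

Lemma dyadic_expz (z : int) a : dyadic a -> dyadic (2 ^ z * a).
Proof.
move=> [m [k ->]]; case: z => n.
  exists (2 ^+ n * m), k; rewrite rmorphM rmorphXn /= mulrA.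
  by rewrite exprnP.
exists m, (n.+1 + k)%N; have -> : 2 ^ Negz n = (2 ^+ n.+1)^-1 :> R by [].
by rewrite exprD invfM mulrCA.
Qed.

(** The breakpoints are multiples of some 2^-k, and the interval of a word of
    length at least k has no such multiple in its interior. *)
Lemma partition_fine s : dyadic_partition s ->
  exists k, forall u, (k <= size u)%N ->
    exists2 i, (i < size s)%N & word_itv u `<=` piece s i.
Proof.
move=> [[s_path /eqP s_last] s_dyadic].
have [k kP] : exists k, forall n, (k <= n)%N -> forall i, (i < size s)%N ->
    exists m : int, nth 1 s i = m%:~R / 2 ^+ n.
  by apply: finite_eventually => i i_s; apply/dyadic_num/s_dyadic/mem_nth.
exists k => u ku; have [c c_lt uE] := @word_pt_numeral R u.
have p2 : 0 < 2 ^+ size u :> R by exact: exprn_gt0.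
pose right_of b := word_pt u (1 : R) <= b.
have has_s : has right_of s.
  have s_gt0 : (0 < size s)%N.
    by case: (s) s_last => //= /eqP; rewrite eq_sym oner_eq0.
  apply/(has_nthP 1); exists (size s).-1; first by rewrite prednK.
  rewrite nth_last; have -> : last 1 s = 1 by case: (s) s_last s_gt0.
  by case/andP: (@word_pt01 R u 1 ltac:(lra)).
exists (find right_of s); first by rewrite -has_find.
(* The piece is the first one whose right end is not left of [u]; the previous
   breakpoint lies left of the right end of [u], hence of its left end. *)
have left_of : nth 1 (0 :: s) (find right_of s) <= word_pt u 0.
  case fE : (find right_of s) => [|i] /=.
    by case/andP: (@word_pt01 R u 0 ltac:(lra)).
  have is_s : (i < size s)%N.
    by have := has_s; rewrite has_find fE; exact: ltnW.
  have [m mE] := kP _ ku _ is_s.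
  have := @before_find _ 1 right_of s i; rewrite fE ltnSn => /(_ isT).
  rewrite /right_of mE !uE; move/negbT; rewrite -ltNge.
  rewrite ltr_pM2r ?invr_gt0 // ler_pM2r ?invr_gt0 // addr0.
  rewrite -[c%:R]/((c%:Z)%:~R) -[1]/(1%:~R) -rmorphD /= ltr_int ler_int /=.
  by rewrite ltzD1.
have := nth_find 1 has_s; rewrite /right_of => right_ofP.
move=> a /word_itvP[t t01 ->]; rewrite /piece /= in_itv /=; apply/andP; split.
  apply: (le_trans left_of); have [->|tn] := eqVneq t 0; rewrite // ltW //.
  by apply: word_pt_lt; lra.
apply: le_trans right_ofP; have [->|tn] := eqVneq t 1; rewrite // ltW //.
by apply: word_pt_lt; lra.
Qed.

End Partitions.

(** * Thompson's group and its subgroups in terms of words *)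

Section WordLocal.
Variable R : realType.
Implicit Types (u v w : seq bool) (s : seq R) (a b t : R) (x y : I01 R).
Implicit Types (f g h : I01 R -> I01 R) (rho : seq bool -> seq bool -> Prop).

Definition increasing_homeo f : Prop :=
  homeomorphism f /\ {homo f : x y / pt x < pt y}.

(** For the trivial relation this describes F itself. For being mapped to
    each other by an element of H it says that [f] is piecewise in H, and for
    having the same reading in the core that [f] preserves reading; one proof that
    these maps form a group serves both. *)
Definition word_local rho f : Prop := exists k, forall u, (k <= size u)%N ->
  exists2 v, maps_word f u v & rho u v.

Record congruence rho : Prop := Congruence {
  cong_refl : forall u, rho u u;
  cong_sym : forall u v, rho u v -> rho v u;
  cong_trans : forall u v w, rho u v -> rho v w -> rho u w;
  cong_cat : forall u v w, rho u v -> rho (u ++ w) (v ++ w) }.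

Lemma increasing_homeo_id : increasing_homeo id.
Proof. by split=> //; exists id; split=> // x; exact: cvg_id. Qed.

Lemma increasing_homeo_comp f g :
  increasing_homeo f -> increasing_homeo g -> increasing_homeo (f \o g).
Proof.
move=> [[f' [fK f'K f_cont f'_cont]] f_incr] [[g' [gK g'K g_cont g'_cont]] g_incr].
split; last by move=> x y xy; exact/f_incr/g_incr.
exists (g' \o f'); split.
- exact: can_comp.
- exact: can_comp.
- by move=> x; apply: continuous_comp; [exact: g_cont|exact: f_cont].
- by move=> x; apply: continuous_comp; [exact: f'_cont|exact: g'_cont].
Qed.

Lemma increasing_homeo_inv f g : cancel f g -> cancel g f ->
  increasing_homeo f -> increasing_homeo g.
Proof.
move=> fK gK [[f' [f'K fK' f_cont f'_cont]] f_incr].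
have gE : g = f'.
  by apply/funext => x; rewrite -{1}[x]fK' fK.
split; first by exists f; rewrite gE; split => //; rewrite -gE.
move=> x y xy; case: (ltgtP (pt (g x)) (pt (g y))) => //.
  by move=> /f_incr; rewrite !gK => /(lt_trans xy); rewrite ltxx.
by move=> /pt_inj /(congr1 f); rewrite !gK => e; rewrite e ltxx in xy.
Qed.

Lemma increasing_homeo_fix0 f x : increasing_homeo f ->
  pt x = 0 -> pt (f x) = 0.
Proof.
move=> [[g [fK gK _ _]] f_incr] x0.
suff gx : g x = x by rewrite -{1}gx gK.
apply: pt_inj; have := pt_bounds (g x); have := pt_bounds (f x) => fx gx.
apply/eqP; rewrite x0; case: (ltgtP (pt (g x)) 0) => //; first by lra.
by rewrite -x0 => /f_incr; rewrite gK x0; lra.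
Qed.

(** With slope 2^z and [n] large, the image of a dyadic interval of length 2^-n
    has length 2^-N for N = n - z, and its left end is a multiple of 2^-N
    because so is the constant term. *)
Lemma affine_maps_word f (z : int) b : dyadic b ->
  exists k, forall n, (k <= n)%N -> forall u, size u = n ->
    affine_on (word_itv u) f (2 ^ z) b -> exists v, maps_word f u v.
Proof.
move=> /dyadic_num[k kb]; exists (k + `|z|)%N => n kn u un fu.
have [N NE] : exists N : nat, n%:Z - z = N%:Z.
  by exists `|(n%:Z - z)%R|%N; lia.
have [m bE] : exists m : int, b = m%:~R / 2 ^+ N by apply: kb; lia.
have [c c_lt uE] := @word_pt_numeral R u.
have zE : 2 ^ z = 2 ^+ n / 2 ^+ N :> R by rewrite -expz_subn; congr (_ ^ _); lia.
have pn : 2 ^+ n != 0 :> R by rewrite expf_neq0.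
have pN : 0 < 2 ^+ N :> R by exact: exprn_gt0.
(* In the units 2^-n and 2^-N the map [f] is translation by [m] *)
have fE x t : 0 <= t <= 1 -> pt x = word_pt u t ->
    pt (f x) = ((c%:Z + m)%:~R + t) / 2 ^+ N.
  move=> t01 xE; rewrite fu; last by apply/word_itvP; exists t.
  rewrite xE uE un zE bE rmorphD /=; field.
  by rewrite pn lt0r_neq0.
have t0 : 0 <= (0 : R) <= 1 by lra.
have t1 : 0 <= (1 : R) <= 1 by lra.
have [x0 x0E] := pt_surj (word_pt01 u t0).
have [x1 x1E] := pt_surj (word_pt01 u t1).
have := pt_bounds (f x0); rewrite (fE _ _ t0 x0E) addr0 => /andP[+ _].
rewrite pmulr_lge0 ?invr_gt0 // ler0z => cm0.
have := pt_bounds (f x1); rewrite (fE _ _ t1 x1E) => /andP[_].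
rewrite ler_pdivrMr // mul1r -[X in _ + X](rmorph1 intr) -rmorphD /=.
rewrite -[2 ^+ N]/((2%:Z)%:~R ^+ N) -rmorphXn /= ler_int => cm1.
have [d dE] : exists d : nat, c%:Z + m = d%:Z.
  by exists `|(c%:Z + m)%R|%N; lia.
have dN : (d < 2 ^ N)%N.
  have p2E : (2%:Z) ^+ N = (2 ^ N)%N%:Z by rewrite -!natz natrX.
  by move: cm1; rewrite dE p2E; lia.
have [v vN vE] := @word_of_numeral R _ _ dN.
by exists v => x t t01 xE; rewrite (fE _ _ t01 xE) dE vE.
Qed.

Lemma piece_left_end s i : dyadic_partition s -> (i < size s)%N ->
  exists y, [/\ pt y = nth 1 (0 :: s) i, dyadic (pt y) & piece s i (pt y)].
Proof.
move=> [s_part s_dyadic] i_s.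
have ends_le : nth 1 (0 :: s) i <= nth 1 s i.
  by case: s_part => /(pathP 1) s_path _; exact/ltW/s_path.
have [y yE] : exists y : I01 R, pt y = nth 1 (0 :: s) i.
  apply: pt_surj; rewrite (itv_partition_nth_ge _ s_part) ?ltnS 1?ltnW //.
  by rewrite (itv_partition_nth_le _ s_part) ?ltnS 1?ltnW.
exists y; split=> //; last by rewrite /piece /= in_itv /= yE lexx.
rewrite yE; case: (i) i_s => [|j] js; first by exists 0, 0%N; rewrite mul0r.
exact/s_dyadic/mem_nth/ltnW.
Qed.

(** The map fixes 0, and on each piece it changes by a power of 2 times the
    dyadic length of the piece. *)
Lemma thompsonF_breakpoints f s : increasing_homeo f -> dyadic_partition s ->
  (forall i, (i < size s)%N ->
     exists (k : int) b, affine_on (piece s i) f (2 ^ k) b) ->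
  forall i, (i <= size s)%N -> forall x, pt x = nth 1 (0 :: s) i ->
    dyadic (pt (f x)).
Proof.
move=> f_homeo s_part f_aff; elim=> [|i IH] i_s x xE.
  by rewrite (increasing_homeo_fix0 f_homeo xE); exists 0, 0%N; rewrite mul0r.
have [y [yE y_dyadic yP]] := piece_left_end s_part i_s.
have [k [b fE]] := f_aff _ i_s.
have xP : piece s i (pt x).
  move: yP; rewrite /piece /= !in_itv /= => /andP[_ y_le].
  by rewrite xE /= lexx andbT -yE (le_trans _ y_le).
have x_dyadic : dyadic (pt x).
  by rewrite xE; case: s_part => _; apply; exact: mem_nth.
have -> : pt (f x) = pt (f y) + (2 ^ k * pt x + - (2 ^ k * pt y)).
  by rewrite (fE _ xP) (fE _ yP); ring.
apply: dyadicD; first exact: (IH (ltnW i_s)).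
by apply: dyadicD; [|apply: dyadicN]; exact: dyadic_expz.
Qed.

Lemma thompsonF_word f : thompsonF f ->
  exists k, forall u, (k <= size u)%N -> exists v, maps_word f u v.
Proof.
move=> [f_homeo f_incr [s s_dyadic f_aff]].
have f_ih : increasing_homeo f by [].
have [k0 k0P] := partition_fine s_dyadic.
have f_break := thompsonF_breakpoints f_ih s_dyadic f_aff.
have [k kP] : exists k, forall n, (k <= n)%N -> forall i, (i < size s)%N ->
    forall u, size u = n -> word_itv u `<=` piece s i ->
    exists v, maps_word f u v.
  apply: finite_eventually => i i_s; have [z [b fE]] := f_aff _ i_s.
  have [y [yE y_dyadic yP]] := piece_left_end s_dyadic i_s.
  have b_dyadic : dyadic b.
    have -> : b = pt (f y) + - (2 ^ z * pt y) by rewrite (fE _ yP); ring.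
    apply: dyadicD; first exact: (f_break _ (ltnW i_s)).
    exact/dyadicN/dyadic_expz.
  have [k kP] := affine_maps_word f z b_dyadic.
  exists k => n kn u un us; apply: (kP _ kn _ un) => x xu.
  exact/fE/us.
exists (maxn k0 k) => u; rewrite geq_max => /andP[k0u ku].
by have [i i_s us] := k0P _ k0u; exact: (kP _ ku _ i_s).
Qed.

Lemma word_thompsonF f k : increasing_homeo f ->
  (forall u, size u = k -> exists v, maps_word f u v) -> thompsonF f.
Proof.
move=> [f_homeo f_incr] f_word; split=> //.
exists (uniform_partition R k); first exact: uniform_partition_dyadic.
move=> i /uniform_partition_piece[u uk ->].
have [v fv] := f_word _ uk; have [b fb] := maps_word_affine fv.
by exists ((size u)%:Z - (size v)%:Z), b.
Qed.

Lemma word_local_thompsonF rho f :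
  increasing_homeo f -> word_local rho f -> thompsonF f.
Proof.
move=> f_ih [k f_word]; apply: (word_thompsonF f_ih (k := k)) => u uk.
by have [v fv _] := f_word u ltac:(by rewrite uk); exists v.
Qed.

(** A word [w ++ w'] goes to [v ++ w'] under [g], so it only has to be long
    enough for [w'] alone to have the length that [f] requires. *)
Lemma word_local_comp rho f g : congruence rho ->
  word_local rho f -> word_local rho g -> word_local rho (f \o g).
Proof.
move=> rhoP [k kf] [l lg]; exists (l + k)%N => u lku.
have [w [w' [uE wl]]] : exists w w', u = w ++ w' /\ size w = l.
  exists (take l u), (drop l u); rewrite cat_take_drop size_takel //.
  exact: leq_trans (leq_addr _ _) lku.
have [v gv wv] := lg w ltac:(by rewrite wl).
have vw'k : (k <= size (v ++ w'))%N.
  by move: lku; rewrite uE !size_cat wl leq_add2l => /leq_trans; apply; exact: leq_addl.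
have [v' fv' vv'] := kf _ vw'k.
exists v'; first by rewrite uE; apply: maps_word_comp fv'; exact: maps_word_cat.
by apply: (cong_trans rhoP) vv'; rewrite uE; exact: (cong_cat rhoP).
Qed.

(** The images of the words of length [k] cover [0, 1], so one of them contains
    the midpoint of any given dyadic interval; a word at least as long as all of
    these images then extends one of them. *)
Lemma word_local_inv rho f g : congruence rho -> cancel f g -> cancel g f ->
  word_local rho f -> word_local rho g.
Proof.
move=> rhoP fK gK [k kf].
have [m mP] : exists m, forall u, size u = k ->
    exists v, [/\ maps_word f u v, rho u v & (size v <= m)%N].
  apply: finite_words_bound => [u m n mn [v [fv uv vm]]|u uk].
    by exists v; split=> //; exact: leq_trans mn.
  by have [v fv uv] := kf u ltac:(by rewrite uk); exists (size v), v.
exists m => w' my.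
have t01 : 0 < (2^-1 : R) < 1 by lra.
have [z zE] : exists z : I01 R, pt z = word_pt w' 2^-1.
  by apply: pt_surj; apply: word_pt01; lra.
have [u [t [uk t_01 gzE]]] := word_pt_cover k (pt_bounds (g z)).
have [v [fv uv vm]] := mP _ uk.
have zE' : word_pt w' 2^-1 = word_pt v t by rewrite -zE -[z]gK; exact: fv.
have [w w'E] := word_pt_nested (leq_trans vm my) t01 t_01 zE'.
exists (u ++ w); first by rewrite w'E; exact/maps_word_cat/(maps_word_inv fK).
by rewrite w'E; apply: (cong_cat rhoP); exact: (cong_sym rhoP).
Qed.

Definition word_localF rho : set (I01 R -> I01 R) :=
  [set f | thompsonF f /\ word_local rho f].

Lemma thompsonF_increasing_homeo f : thompsonF f -> increasing_homeo f.
Proof. by case. Qed.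

Lemma word_localF_subgroup rho : congruence rho -> subgroupF (word_localF rho).
Proof.
move=> rhoP.
have intro f : increasing_homeo f -> word_local rho f -> word_localF rho f.
  by move=> f_ih f_loc; split=> //; exact: word_local_thompsonF f_loc.
split.
- by move=> f [].
- apply: intro; first exact: increasing_homeo_id.
  exists 0%N => u _; exists u; first exact: maps_word_id.
  exact: (cong_refl rhoP).
- move=> f g [/thompsonF_increasing_homeo f_ih fl] [/thompsonF_increasing_homeo g_ih gl].
  by apply: intro; [exact: increasing_homeo_comp|exact: word_local_comp].
- move=> f g [/thompsonF_increasing_homeo f_ih fl] fK gK.
  by apply: intro; [exact: increasing_homeo_inv f_ih|exact: word_local_inv fl].
Qed.

End WordLocal.

(** * Piecewise-H maps *)

Section PiecewiseH.
Variable R : realType.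
Variable H : set (I01 R -> I01 R).
Hypothesis H_sub : subgroupF H.
Implicit Types (u v w : seq bool) (f g h : I01 R -> I01 R).

Definition maps_by u v : Prop := exists2 h, H h & maps_word h u v.

Lemma maps_by_congruence : congruence maps_by.
Proof.
case: H_sub => HF H1 HM HV; split.
- by move=> u; exists id => //; exact: maps_word_id.
- move=> u v [h Hh hv]; have [[g [hK gK _ _]] _ _] := HF _ Hh.
  by exists g; [exact: (HV _ _ Hh hK gK)|exact: (maps_word_inv hK hv)].
- move=> u v w [h Hh hv] [h' Hh' h'w]; exists (h' \o h); first exact: HM.
  exact: maps_word_comp h'w.
- by move=> u v w [h Hh hv]; exists h => //; exact: maps_word_cat.
Qed.

(** A dyadic partition is refined by the words of any large length, and the
    words of one length form a dyadic partition. *)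
Lemma piecewise_word_local f : thompsonF f ->
  (exists2 s, dyadic_partition s &
     forall i, (i < size s)%N ->
       (exists a b : R, affine_on (piece s i) f a b) /\
       exists2 h, H h & forall x : I01 R, piece s i (pt x) -> f x = h x)
  <-> word_local maps_by f.
Proof.
move=> fF; split=> [[s s_dyadic fs]|[k fk]].
  have [k kP] := partition_fine s_dyadic.
  have [l lP] := thompsonF_word fF.
  exists (maxn k l) => u; rewrite geq_max => /andP[ku lu].
  have [i i_s us] := kP _ ku; have [_ [h Hh fh]] := fs _ i_s.
  have [v fv] := lP _ lu; exists v => //; exists h => //.
  by apply: eq_maps_word fv => x xu; rewrite fh //; exact: us.
exists (uniform_partition R k); first exact: uniform_partition_dyadic.
move=> i /uniform_partition_piece[u uk ->].
have [v fv [h Hh hv]] := fk u (eq_leq (esym uk)).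
split; first by have [b fb] := maps_word_affine fv; eexists; exists b; exact: fb.
by exists h => // x xu; exact: maps_word_eq fv hv xu.
Qed.

End PiecewiseH.

(** * Reading words in a folded complex *)

Section Reading.
Variable L : complex.
Hypothesis top_inj : injective (@top L).
Hypothesis bot_inj : forall c c' : cell L,
  lbot c = lbot c' -> rbot c = rbot c' -> c = c'.
Variable p : edge L.
Implicit Types (u v w : seq bool) (e : edge L) (c : cell L).

Definition bot (b : bool) c : edge L := if b then rbot c else lbot c.

(** A pair [(e, x)] is the edge reached by the longest readable prefix of a
    word, together with the rest of the word. Keeping the rest makes reading
    total: it amounts to growing a free binary tree below every edge that is not
    the top of a cell. *)
Definition state : Type := (edge L * seq bool)%type.
Implicit Types s : state.

Definition alive s : Prop := s.2 = [::] /\ exists c, top c = s.1.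

Definition step s (b : bool) : state :=
  match pselect (alive s) with
  | left s_alive => (bot b (projT1 (cid s_alive.2)), [::])
  | right _ => (s.1, rcons s.2 b)
  end.

Definition read u : state := foldl step (p, [::]) u.

Lemma step_cell c b : step (top c, [::]) b = (bot b c, [::]).
Proof.
rewrite /step; case: pselect => [[? ex]|[]]; last by split=> //; exists c.
by case: cid => c' /= /top_inj ->.
Qed.

Lemma step_dead s b : ~ alive s -> step s b = (s.1, rcons s.2 b).
Proof. by rewrite /step; case: pselect. Qed.

Lemma step_alive s : alive s ->
  exists2 c, s = (top c, [::]) & forall b, step s b = (bot b c, [::]).
Proof.
by case: s => e x [/= -> [c <-]]; exists c => // b; exact: step_cell.
Qed.

Lemma dead_step s b : ~ alive s -> ~ alive (step s b).
Proof.
by move=> dead; rewrite step_dead // => -[/=]; case: (s.2).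
Qed.

(** Below a cell this is the folding of cells with equal bottom edges; below a
    dead end it holds because the unread letters are kept. *)
Lemma step_glue s s' : (forall b, step s b = step s' b) -> s = s'.
Proof.
move=> e; have := (e false, e true).
case: (pselect (alive s)) => [/step_alive[c -> sE]|dead];
  case: (pselect (alive s')) => [/step_alive[c' -> s'E]|dead'].
- by rewrite !sE !s'E => -[[l] [r]]; rewrite (bot_inj l r).
- by rewrite !sE !step_dead // => -[] [_]; case: (s'.2).
- by rewrite !s'E !step_dead // => -[] [_]; case: (s.2).
- rewrite !step_dead // => -[] + _; case: s {e dead} => a x.
  by case: s' {dead'} => a' x' /= [-> /rcons_inj[->]].
Qed.

Lemma read_rcons u b : read (rcons u b) = step (read u) b.
Proof. exact: foldl_rcons. Qed.

Lemma read_cat u w : read (u ++ w) = foldl step (read u) w.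
Proof. exact: foldl_cat. Qed.

Lemma read_congruence : congruence (fun u v => read u = read v).
Proof.
split=> // [u v w -> //|u v w e].
by rewrite !read_cat e.
Qed.

(** The unread part of [u] is a suffix of [u], and the prefix left is where the
    reading first stopped. *)
Lemma read_suffix u : exists v,
  [/\ u = v ++ (read u).2, read v = ((read u).1, [::]) &
      ~ alive (read u) -> ~ alive (read v)].
Proof.
elim/last_ind: u => [|u b [v [uE vE dead]]]; first by exists [::].
rewrite read_rcons; case: (pselect (alive (read u))) => [u_alive|u_dead].
  have [c uE' stepE] := step_alive u_alive; rewrite stepE.
  by exists (rcons u b); rewrite cats0 read_rcons stepE.
exists v; rewrite step_dead //=; split=> [|//|_]; last exact: dead.
by rewrite {1}uE rcons_cat.
Qed.

Lemma dead_read_cat u w : ~ alive (read u) ->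
  read (u ++ w) = ((read u).1, (read u).2 ++ w).
Proof.
move=> dead; elim/last_ind: w => [|w b IH].
  by rewrite !cats0; case: (read u).
rewrite -rcons_cat read_rcons step_dead IH ?rcons_cat //.
rewrite -IH; elim/last_ind: w {IH} => [|w c IH]; first by rewrite cats0.
by rewrite -rcons_cat read_rcons; exact: dead_step.
Qed.

(** A dead end is not read twice along one word. *)
Lemma dead_read_unique u w : ~ alive (read u) -> read (u ++ w) = read u ->
  w = [::].
Proof.
move=> dead; rewrite (dead_read_cat w dead).
case: (read u) => e x /= [] /(congr1 size); rewrite size_cat => /eqP.
by rewrite -[X in _ == X]addn0 eqn_add2l size_eq0 => /eqP.
Qed.

Section MapsRead.
Variables (R : realType) (f : I01 R -> I01 R).
Hypothesis f_read : word_local (fun u v => read u = read v) f.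

(** True for long words, and inherited by a word from its two extensions by one
    letter. *)
Lemma maps_word_read u v : maps_word f u v -> read u = read v.
Proof.
have [k kf] := f_read.
have [n] : exists n, (k <= size u + n)%N by exists k; exact: leq_addl.
elim: n u v => [|n IH] u v; rewrite ?addn0 => ku fv.
  by have [v' fv' ->] := kf _ ku; rewrite (maps_word_inj fv fv').
apply: step_glue => b; rewrite -!read_rcons; apply: IH.
  by rewrite size_rcons addSnnS.
by rewrite -!cats1; exact: maps_word_cat.
Qed.

(** Below a dead end there is no room for a breakpoint. Let [x] be the unread
    part of [u]. By induction on the number of missing letters, the two halves
    of [u] go to [v0 ++ rcons x false] and [v1 ++ rcons x true], where [v0] and
    [v1] read the same dead end. The image of the midpoint of [u] is interior to
    both [v0] and [v1], so one of them extends the other, and a dead end is not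
    read twice along one word. Hence [v0 = v1] and [u] goes to [v0 ++ x]. *)
Lemma dead_maps_word u : ~ alive (read u) -> exists v, maps_word f u v.
Proof.
have [k kf] := f_read.
have [n] : exists n, (k <= size u + n)%N by exists k; exact: leq_addl.
elim: n u => [|n IH] u; rewrite ?addn0 => ku dead.
  by have [v fv _] := kf _ ku; exists v.
have half b : exists v, [/\ maps_word f (rcons u b) (v ++ rcons (read u).2 b),
    read v = ((read u).1, [::]) & ~ alive (read v)].
  have deadb : ~ alive (read (rcons u b)) by rewrite read_rcons; exact: dead_step.
  have [v fv] := IH (rcons u b) ltac:(by rewrite size_rcons addSnnS) deadb.
  have vE := maps_word_read fv.
  have [v' []] := read_suffix v.
  rewrite -vE read_rcons step_dead //= => v'E v'read v'dead.
  exists v'; rewrite -v'E; split=> //; apply: v'dead.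
  by rewrite -step_dead //; exact: dead_step.
have [v0 [f0 v0E v0dead]] := half false; have [v1 [f1 v1E v1dead]] := half true.
have t0 : 0 <= (0 : R) <= 1 by lra.
have t1 : 0 <= (1 : R) <= 1 by lra.
have t2 : 0 <= (2^-1 : R) <= 1 by lra.
have [x xE] := pt_surj (word_pt01 u t2).
have x0 : pt x = word_pt (rcons u false) 1.
  by rewrite xE word_pt_rcons /=; congr word_pt; lra.
have x1 : pt x = word_pt (rcons u true) 0.
  by rewrite xE word_pt_rcons /=; congr word_pt; lra.
have := f1 _ _ t0 x1; rewrite (f0 _ _ t1 x0) !word_pt_cat !word_pt_rcons /=.
have -> : (0 + 1) / 2 = 2^-1 :> R by lra.
have -> : (1 + 0) / 2 = 2^-1 :> R by lra.
have : 0 < word_pt (read u).2 (2^-1 : R) < 1 by apply: word_pt_interior; lra.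
move: (word_pt _ _) => t t01 vv.
have vE : v0 = v1.
  have t01' : 0 <= t <= 1 by lra.
  case/orP: (leq_total (size v1) (size v0)) => vs.
    have [w wE] := word_pt_nested vs t01 t01' vv.
    have w0 : w = [::] by apply: dead_read_unique v1dead _; rewrite -wE v0E.
    by rewrite wE w0 cats0.
  have [w wE] := word_pt_nested vs t01 t01' (esym vv).
  have w0 : w = [::] by apply: dead_read_unique v0dead _; rewrite -wE v1E.
  by rewrite wE w0 cats0.
exists (v0 ++ (read u).2); apply: maps_word_glue => -[].
  by rewrite rcons_cat vE.
by rewrite rcons_cat.
Qed.

End MapsRead.

End Reading.

(** * Trees and maps of diagrams *)

Section Trees.
Implicit Types (t : tree) (u v w : seq bool) (b : bool).

Lemma is_node_rcons t u b : is_node t (rcons u b) -> is_inner t u.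
Proof.
rewrite /is_inner /is_node.
by elim: u t => [|c u IH] [|l r] //=; exact: IH.
Qed.

Lemma leaf_prefix t : exists k, forall u, (k <= size u)%N ->
  exists i w, (i < size (leaves t))%N /\ u = leaf_addr t i ++ w.
Proof.
suff [k kP] : exists k, forall u, (k <= size u)%N ->
    exists l w, l \in leaves t /\ u = l ++ w.
  exists k => u /kP[l [w [/(nthP [::])[i i_t <-] ->]]].
  by exists i, w.
elim: t => [|l [kl IHl] r [kr IHr]] /=.
  by exists 0%N => u _; exists [::], u; rewrite mem_seq1.
exists (maxn kl kr).+1 => -[|b u] //=; rewrite ltnS geq_max => /andP[lu ru].
case: b.
  have [x [w [xr ->]]] := IHr _ ru; exists (true :: x), w; split=> //.
  by rewrite mem_cat; apply/orP; right; apply: map_f.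
have [x [w [xl ->]]] := IHl _ lu; exists (false :: x), w; split=> //.
by rewrite mem_cat; apply/orP; left; apply: map_f.
Qed.

Lemma is_node_leaf t i : (i < size (leaves t))%N -> is_node t (leaf_addr t i).
Proof. by move=> /leaves_before_leaf[_ e]; rewrite /is_node e. Qed.

Lemma leaves_gt0 t : (0 < size (leaves t))%N.
Proof. by elim: t => //= l IHl r IHr; rewrite size_cat !size_map addn_gt0 IHl. Qed.

Lemma leaves_before_inner t u : is_inner t u ->
  [/\ leaves_before t (rcons u false) = leaves_before t u,
      leaves_before t (rcons u true)
        = (leaves_before t u + leaves_below t (rcons u false))%N &
      leaves_below t u
        = (leaves_below t (rcons u false) + leaves_below t (rcons u true))%N].
Proof.
rewrite /is_inner /leaves_below.
elim: u t => [|c u IH] [|l r] //=; first by rewrite addn0 size_cat !size_map.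
by case: c => /IH[-> -> ->] //; rewrite addnA.
Qed.

Lemma leaves_before_below t u : is_node t u ->
  (leaves_before t u + leaves_below t u <= size (leaves t))%N.
Proof.
rewrite /is_node /leaves_below.
elim: u t => [|c u IH] [|l r] //=; rewrite size_cat !size_map.
case: c => /IH; first by rewrite -addnA leq_add2l.
by move=> h; exact: leq_trans h (leq_addr _ _).
Qed.

End Trees.

(** The incidences between the vertices of a cell and those of its edges. They
    hold in a diagram and survive unions and foldings. *)
Record triangular (L : complex) : Prop := Triangular {
  ini_lbot : forall c : cell L, ini (lbot c) = ini (top c);
  ter_lbot : forall c : cell L, ter (lbot c) = ini (rbot c);
  ter_rbot : forall c : cell L, ter (rbot c) = ter (top c) }.

Lemma diagram_triangular D : triangular (diagram D).
Proof.
have cellE (c : tp_cell D) :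
    [/\ tp_ini (tp_bot false c) = tp_ini (tp_top c),
        tp_ter (tp_bot false c) = tp_ini (tp_bot true c) &
        tp_ter (tp_bot true c) = tp_ter (tp_top c)].
  by case: c => -[u /= /leaves_before_inner[-> -> ->]]; rewrite !addnA.
split=> c; have [e1 e2 e3] := cellE c.
- exact: etrans (diagram_ini _) (etrans e1 (esym (diagram_ini _))).
- exact: etrans (diagram_ter _) (etrans e2 (esym (diagram_ini _))).
- exact: etrans (diagram_ter _) (etrans e3 (esym (diagram_ter _))).
Qed.

Lemma disjoint_union_triangular I (K : I -> complex) :
  (forall i, triangular (K i)) -> triangular (disjoint_union K).
Proof.
by move=> Ktri; split=> -[i c] /=; have [i1 i2 i3] := Ktri i; rewrite ?i1 ?i2 ?i3.
Qed.

Section FoldedComplex.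
Variables (K : complex) (r : edge K -> edge K -> Prop).
Let L := folded r.

Lemma folded_top_inj : injective (@top L).
Proof.
move=> c c' /clsP/clos_fold_edge e; rewrite -[c]repK -[c']repK.
by apply/clsP/rst_step/fold_cell_top.
Qed.

Lemma folded_bot_inj (c c' : cell L) :
  lbot c = lbot c' -> rbot c = rbot c' -> c = c'.
Proof.
move=> /clsP/clos_fold_edge el /clsP/clos_fold_edge er.
by rewrite -[c]repK -[c']repK; apply/clsP/rst_step/fold_cell_bot.
Qed.

Lemma folded_triangular : triangular K -> triangular L.
Proof.
move=> Ktri; split=> c.
- apply: etrans (folded_ini _ _) (etrans _ (esym (folded_ini _ _))).
  by rewrite (ini_lbot Ktri).
- apply: etrans (folded_ter _ _) (etrans _ (esym (folded_ini _ _))).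
  by rewrite (ter_lbot Ktri).
- apply: etrans (folded_ter _ _) (etrans _ (esym (folded_ter _ _))).
  by rewrite (ter_rbot Ktri).
Qed.

Definition fold_map : complex_map K L :=
  @ComplexMap K L (cls (@fold_vertex K r)) (cls (@fold_edge K r))
    (cls (@fold_cell K r)) (@folded_ini K r) (@folded_ter K r)
    (fun c => let: And3 e _ _ := folded_cell r c in e)
    (fun c => let: And3 _ e _ := folded_cell r c in e)
    (fun c => let: And3 _ _ e := folded_cell r c in e).

End FoldedComplex.

Definition union_map I (K : I -> complex) (i : I) :
    complex_map (K i) (disjoint_union K) :=
  @ComplexMap (K i) (disjoint_union K) (existT _ i) (existT _ i) (existT _ i)
    (fun=> erefl) (fun=> erefl) (fun=> erefl) (fun=> erefl) (fun=> erefl).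

Definition comp_map (K L M : complex) (g : complex_map L M) (f : complex_map K L) :
  complex_map K M.
Proof.
refine (@ComplexMap K M (vmap g \o vmap f) (emap g \o emap f) (cmap g \o cmap f)
  _ _ _ _ _) => x /=.
- by rewrite map_ini map_ini.
- by rewrite map_ter map_ter.
- by rewrite map_top map_top.
- by rewrite map_lbot map_lbot.
- by rewrite map_rbot map_rbot.
Defined.

Definition accepts (L : complex) (p : edge L) (E : tree_pair) : Prop :=
  exists phi : complex_map (diagram E) L,
    emap phi (top_edge E) = p /\ emap phi (bot_edge E) = p.

Definition edge_word (E : tree_pair) (x : tp_edge E) : seq bool :=
  match x with inl u => sval u | inr v => sval v end.

Lemma edge_word_bot E b (c : tp_cell E) :
  edge_word (tp_bot b c) = rcons (edge_word (tp_top c)) b.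
Proof. by case: c. Qed.

(** An induction principle for the edges of a diagram, moving down from the two
    roots along the cells. *)
Lemma tp_edge_ind E (P : tp_edge E -> Prop) :
  P (inl (Defs.root (tplus E))) -> P (inr (Defs.root (tminus E))) ->
  (forall b c, P (tp_top c) -> P (tp_bot b c)) -> forall x, P x.
Proof.
have nodeE t u b (ui : is_inner t u) (un : is_node t (rcons u b)) :
    exist _ (rcons u b) un = child b (exist _ u ui : inner t) by exact: val_inj.
have innerE t u (ui : is_inner t u) (un : is_node t u) :
    exist _ u un = inner_node (exist _ u ui : inner t) by exact: val_inj.
move=> Pp Pm Pc [] [u un]; elim/last_ind: u un => [|u b IH] un.
- by rewrite (bool_irrelevance un isT).
- have ui := is_node_rcons un; rewrite (nodeE _ _ _ ui).
  by apply: (Pc b (inl _)); rewrite /= -innerE ?is_inner_node // => un'; exact: IH.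
- by rewrite (bool_irrelevance un isT).
- have ui := is_node_rcons un; rewrite (nodeE _ _ _ ui).
  by apply: (Pc b (inr _)); rewrite /= -innerE ?is_inner_node // => un'; exact: IH.
Qed.

Lemma cls_leaf E i : (i < nleaves E)%N ->
  exists x y : tp_edge E, [/\ edge_word x = leaf_addr (tplus E) i,
    edge_word y = leaf_addr (tminus E) i & cls (@leaf_glue E) x = cls (@leaf_glue E) y].
Proof.
move=> iE; have iE' : (i < size (leaves (tminus E)))%N by rewrite -tpE.
pose leaf t j (jt : (j < size (leaves t))%N) : node t :=
  exist (fun u => is_node t u) (leaf_addr t j) (is_node_leaf jt).
exists (inl (leaf _ _ iE)), (inr (leaf _ _ iE')).
by split=> //; apply/clsP/rst_step/(LeafGlue iE).
Qed.

Section Acceptance.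
Variable L : complex.
Hypothesis top_inj : injective (@top L).
Hypothesis L_tri : triangular L.
Variable p : edge L.
Variable E : tree_pair.
Implicit Types u : seq bool.

Lemma map_bot (phi : complex_map (diagram E) L) b c :
  bot b (cmap phi c) = emap phi (cls (@leaf_glue E) (tp_bot b c)).
Proof. by case: b; [exact: map_rbot|exact: map_lbot]. Qed.

(** Reading the word of a node follows the image of the diagram, because the cell
    below an edge is unique; so reading is compatible with gluing leaves. *)
Lemma accepts_read : accepts p E -> forall i, (i < nleaves E)%N ->
  read p (leaf_addr (tplus E) i) = read p (leaf_addr (tminus E) i).
Proof.
move=> [phi [phi_top phi_bot]].
have readE (x : tp_edge E) :
    read p (edge_word x) = (emap phi (cls (@leaf_glue E) x), [::]).
  elim/tp_edge_ind: x => [||b c IH]; first by rewrite -phi_top.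
    by rewrite -phi_bot.
  rewrite edge_word_bot read_rcons IH -[cls _ _]/(top (c : cell (diagram E))).
  by rewrite -map_top (step_cell top_inj) map_bot.
by move=> i /cls_leaf[x [y [<- <- xy]]]; rewrite !readE xy.
Qed.

(** Here [V j] is the image of the vertex [j] of a diagram. The two subtrees of a
    node overlap in one vertex, where the incidence of its cell applies. *)
Lemma tree_vertices t (q : seq bool -> edge L) :
  (forall u, is_inner t u ->
     [/\ ini (q (rcons u false)) = ini (q u),
         ter (q (rcons u false)) = ini (q (rcons u true)) &
         ter (q (rcons u true)) = ter (q u)]) ->
  exists V : nat -> vertex L, forall u, is_node t u ->
    ini (q u) = V (leaves_before t u) /\
    ter (q u) = V (leaves_before t u + leaves_below t u)%N.
Proof.
elim: t q => [|l IHl r IHr] q qP.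
  by exists (fun j => if j is 0%N then ini (q [::]) else ter (q [::])) => -[].
have [Vl VlP] := IHl (fun u => q (false :: u)) (fun u => qP (false :: u)).
have [Vr VrP] := IHr (fun u => q (true :: u)) (fun u => qP (true :: u)).
have [/= q0 q01 q1] := qP [::] isT.
have [l0 l1] := VlP [::] isT; have [r0 r1] := VrP [::] isT.
pose n := size (leaves l); pose V j := if (j <= n)%N then Vl j else Vr (j - n)%N.
have VlE j : (j <= n)%N -> V j = Vl j by rewrite /V => ->.
have VrE j : V (n + j)%N = Vr j.
  rewrite /V; case: j => [|j]; last by rewrite addnS ltnNge leq_addr /= -addnS addKn.
  by rewrite addn0 leqnn -[n]/(0 + leaves_below l [::])%N -l1 q01 r0.
exists V => -[|[] u] /= u_node.
- rewrite VlE // -q0 l0; split=> //.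
  rewrite /leaves_below /= size_cat !size_map add0n VrE -q1 r1.
  by [].
- have [-> ->] := VrP _ u_node; split; first by rewrite VrE.
  by rewrite -/n -addnA VrE.
- have [-> ->] := VlP _ u_node.
  have u_le : (leaves_before l u + leaves_below l u <= n)%N.
    exact: leaves_before_below.
  by rewrite !VlE //; exact: leq_trans (leq_addr _ _) u_le.
Qed.

(** Reading labels the nodes of both trees by edges of [L]. An inner node is
    alive and so provides the image of its cell, and the two trees give the same
    images of vertices because these are the ends of the leaves. *)
Lemma read_accepts :
  (forall u, is_inner (tplus E) u -> alive (read p u)) ->
  (forall u, is_inner (tminus E) u -> alive (read p u)) ->
  (forall i, (i < nleaves E)%N ->
     read p (leaf_addr (tplus E) i) = read p (leaf_addr (tminus E) i)) ->
  accepts p E.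
Proof.
move=> aliveP aliveM leafE.
have clsE (x y : tp_edge E) : cls (@leaf_glue E) x = cls (@leaf_glue E) y ->
    read p (edge_word x) = read p (edge_word y).
  move=> /clsP; elim=> {x y} [_ _ [u v i iE /= -> ->]|//|x y _ ->//|x y z _ -> _ ->//].
  exact: leafE.
have cell_alive (c : tp_cell E) : alive (read p (edge_word (tp_top c))).
  by case: c => -[u u_inner]; [exact: aliveP|exact: aliveM].
have cellP (c : tp_cell E) : exists c' : cell L,
    top c' = (read p (edge_word (tp_top c))).1 /\
    forall b, bot b c' = (read p (edge_word (tp_bot b c))).1.
  have [c' readE stepE] := step_alive top_inj (cell_alive c).
  exists c'; rewrite readE; split=> // b.
  by rewrite edge_word_bot read_rcons stepE.
have {}cellP (c : tp_cell E) := cid (cellP c).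
pose q u := (read p u).1.
have incidence u : alive (read p u) ->
    [/\ ini (q (rcons u false)) = ini (q u),
        ter (q (rcons u false)) = ini (q (rcons u true)) &
        ter (q (rcons u true)) = ter (q u)].
  move=> /(step_alive top_inj)[c readE stepE].
  rewrite /q !read_rcons !stepE readE /=.
  by rewrite (ini_lbot L_tri) (ter_lbot L_tri) (ter_rbot L_tri).
have [Vp VpE] := tree_vertices (fun u u_in => incidence u (aliveP u u_in)).
have [Vm VmE] := tree_vertices (fun u u_in => incidence u (aliveM u u_in)).
have before_leaf t i : (i < size (leaves t))%N ->
    leaves_before t (leaf_addr t i) = i /\ leaves_below t (leaf_addr t i) = 1%N.
  by move=> /leaves_before_leaf[b e]; rewrite /leaves_below e.
have V_eq j : (j <= nleaves E)%N -> Vm j = Vp j.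
  have leaf i : (i < nleaves E)%N -> Vm i = Vp i /\ Vm (i + 1)%N = Vp (i + 1)%N.
    move=> iE; have iE' : (i < size (leaves (tminus E)))%N by rewrite -tpE.
    have [ip tp] := VpE _ (is_node_leaf iE).
    have [im tm] := VmE _ (is_node_leaf iE').
    move: ip tp im tm; have [-> ->] := before_leaf _ _ iE.
    have [-> ->] := before_leaf _ _ iE'.
    by rewrite /q leafE // => <- <- <- <-.
  rewrite leq_eqVlt => /orP[/eqP->|/leaf[] //].
  have n_gt0 : (0 < nleaves E)%N by exact: leaves_gt0.
  have [_] := leaf (nleaves E).-1 ltac:(by rewrite prednK).
  by rewrite addn1 prednK.
have below_bound (x : tp_edge E) : exists m n,
    [/\ tp_ini x = inord m, tp_ter x = inord n, (m <= nleaves E)%N,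
       (n <= nleaves E)%N & ini (q (edge_word x)) = Vp m /\ ter (q (edge_word x)) = Vp n].
  case: x => -[u u_node] /=; have u_le := leaves_before_below u_node.
    eexists; eexists; split; [reflexivity|reflexivity| |exact: u_le|exact: VpE].
    exact: leq_trans (leq_addr _ _) u_le.
  rewrite -tpE -/(nleaves E) in u_le.
  have u_le' := leq_trans (leq_addr _ _) u_le.
  eexists; eexists; split; [reflexivity|reflexivity|exact: u_le'|exact: u_le|].
  by rewrite -!V_eq //; exact: VmE.
pose vm (j : vertex (diagram E)) := Vp (nat_of_ord (j : 'I_(nleaves E).+1)).
pose em (e : edge (diagram E)) := q (edge_word (rep e)).
pose cm (c : cell (diagram E)) := projT1 (cellP c).
have emE x : em (cls (@leaf_glue E) x) = q (edge_word x).
  by rewrite /em /q (clsE _ x) // repK.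
have em_ini e : ini (em e) = vm (ini e).
  have [m [n [mE nE m_le n_le [-> _]]]] := below_bound (rep e).
  by rewrite /vm /= mE inordK.
have em_ter e : ter (em e) = vm (ter e).
  have [m [n [mE nE m_le n_le [_ ->]]]] := below_bound (rep e).
  by rewrite /vm /= nE inordK.
have cm_top c : top (cm c) = em (top c).
  by rewrite /cm emE; case: (cellP c) => c' [].
have cm_bot b c : bot b (cm c) = em (cls (@leaf_glue E) (tp_bot b c)).
  by rewrite /cm emE; case: (cellP c) => c' [].
exists (@ComplexMap (diagram E) L vm em cm em_ini em_ter cm_top
          (cm_bot false) (cm_bot true)).
by split; rewrite /= emE.
Qed.

End Acceptance.

(** * The minimal tree pair of a map *)

Section CutTree.
Variable P : pred (seq bool).
Implicit Types u w : seq bool.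

Definition minimal w : Prop :=
  P w /\ forall w1 w2, w = w1 ++ w2 -> P w1 -> w2 = [::].

(** The tree of words below [u] cut at the first words satisfying [P]; [n] bounds
    the depth. *)
Fixpoint cut_tree (n : nat) u : tree :=
  if n is m.+1 then
    if P u then Leaf
    else Node (cut_tree m (rcons u false)) (cut_tree m (rcons u true))
  else Leaf.

Lemma cut_tree_inner n u w : is_inner (cut_tree n u) w -> ~~ P (u ++ w).
Proof.
elim: n u w => [|n IH] u [|b w] //=; case: ifP => // Pu; first by rewrite cats0 Pu.
by rewrite -cat_rcons; case: b => /IH.
Qed.

Lemma cut_tree_leaves n u w : (forall w', (n <= size w')%N -> P (u ++ w')) ->
  w \in leaves (cut_tree n u) <->
  P (u ++ w) /\ (forall w1 w2, w = w1 ++ w2 -> P (u ++ w1) -> w2 = [::]).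
Proof.
elim: n u w => [|n IH] u w Pn /=.
  rewrite mem_seq1; split=> [/eqP->|[_ /(_ [::] w erefl)]].
    by split=> [|[|//] []//]; exact: Pn.
  by rewrite cats0 => -> //; have := Pn [::] isT; rewrite cats0.
case: ifP => Pu.
  rewrite mem_seq1; split=> [/eqP->|[_ /(_ [::] w erefl)]].
    by rewrite cats0 Pu; split=> // -[|//] [].
  by rewrite cats0 => ->.
have IHb b := IH (rcons u b) _ (fun w' w'n => eq_rect _ (fun x => is_true (P x))
  (Pn (b :: w') w'n) _ (esym (cat_rcons b u w'))).
rewrite /= mem_cat; case: w => [|b w].
  rewrite cats0 Pu; split=> [|[]//].
  by move=> /orP[] /mapP[].
have memE : (b :: w \in [seq false :: i | i <- leaves (cut_tree n (rcons u false))])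
    || (b :: w \in [seq true :: i | i <- leaves (cut_tree n (rcons u true))])
    = (w \in leaves (cut_tree n (rcons u b))).
  apply/orP/idP => [[] /mapP[w' w'n [-> ->]]//|wn].
  by case: b wn => wn; [right|left]; exact: map_f.
rewrite memE IHb cat_rcons; split=> -[Pw wmin]; split=> // w1 w2.
  case: w1 => [_|c w1 [<- wE]]; first by rewrite cats0 Pu.
  by rewrite -cat_rcons; exact: wmin.
by move=> wE; rewrite cat_rcons; apply: (wmin (b :: w1)); rewrite wE.
Qed.

End CutTree.

Lemma leaves_sorted (R : realType) t :
  sorted (fun u v => word_pt u (0 : R) < word_pt v 0) (leaves t).
Proof.
have lt_tr : transitive (fun u v => word_pt u (0 : R) < word_pt v 0).
  by move=> v u w; exact: lt_trans.
have pt0 u : 0 <= word_pt u (0 : R) < 1.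
  have := @word_pt01 R u 0 ltac:(lra); have := @word_pt_lt R u 0 1 ltac:(lra).
  by have := @word_pt01 R u 1 ltac:(lra); lra.
rewrite sorted_pairwise //; elim: t => [|l IHl r IHr] //=.
rewrite pairwise_cat !pairwise_map; apply/and3P; split.
- apply/allrelP => _ _ /mapP[u _ ->] /mapP[v _ ->] /=.
  by have := pt0 u; have := pt0 v; lra.
- by apply: sub_pairwise IHl => u v /=; lra.
- by apply: sub_pairwise IHr => u v /=; lra.
Qed.

Section MinimalPair.
Variables (R : realType) (f g : I01 R -> I01 R).
Hypotheses (fK : cancel f g) (gK : cancel g f).
Implicit Types u v w : seq bool.

Definition affine_word (h : I01 R -> I01 R) : pred (seq bool) :=
  fun u => `[< exists v, maps_word h u v >].

Lemma minimal_affine_word u v : maps_word f u v ->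
  minimal (affine_word f) u -> minimal (affine_word g) v.
Proof.
move=> fv [_ umin]; split; first by apply/asboolP; exists u; exact: maps_word_inv fv.
move=> v1 v2 vE /asboolP[u1 gu1]; apply: (umin u1).
  apply: (maps_word_inj (maps_word_inv fK fv)).
  by rewrite vE; exact: maps_word_cat.
by apply/asboolP; exists v1; exact: maps_word_inv gu1.
Qed.

End MinimalPair.

(** Both trees are cut where the map, respectively its inverse, becomes affine.
    Minimal words go to minimal words, so the leaves correspond, in order because
    [f] is increasing. The pair is reduced: if sibling leaves went to siblings,
    [f] would already be affine on their parent. *)
Lemma minimal_pair (R : realType) (f g : I01 R -> I01 R) :
  {homo f : x y / pt x < pt y} -> cancel f g -> cancel g f ->
  word_local (fun _ _ => True) f -> word_local (fun _ _ => True) g ->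
  exists E : tree_pair, [/\ reduced_pair_of f E,
    forall u, is_inner (tplus E) u -> ~ exists v, maps_word f u v,
    forall v, is_inner (tminus E) v -> ~ exists u, maps_word g v u &
    forall i, (i < nleaves E)%N ->
      maps_word f (leaf_addr (tplus E) i) (leaf_addr (tminus E) i)].
Proof.
move=> f_incr fK gK [k kf] [l lg].
pose Tp := cut_tree (affine_word f) k [::].
pose Tm := cut_tree (affine_word g) l [::].
have TpP u : u \in leaves Tp <-> minimal (affine_word f) u.
  by apply: cut_tree_leaves => w /kf[v fv _]; apply/asboolP; exists v.
have TmP v : v \in leaves Tm <-> minimal (affine_word g) v.
  by apply: cut_tree_leaves => w /lg[u gu _]; apply/asboolP; exists u.
pose image u := xget [::] [set v | maps_word f u v].
have imageP u : affine_word f u -> maps_word f u (image u).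
  by move=> /asboolP fu; exact: (xgetPex [::] fu).
have leavesE : map image (leaves Tp) = leaves Tm.
  apply: (@irr_sorted_eq _ (fun u v => word_pt u (0 : R) < word_pt v 0)).
  - by move=> v u w; exact: lt_trans.
  - by move=> u; rewrite /= ltxx.
  - apply: (homo_sorted_in (P := affine_word f)) (leaves_sorted R Tp).
      move=> u v uP vP uv.
      have t0 : 0 <= (0 : R) <= 1 by lra.
      have [x xE] := pt_surj (word_pt01 u t0).
      have [y yE] := pt_surj (word_pt01 v t0).
      rewrite -(imageP _ uP _ _ t0 xE) -(imageP _ vP _ _ t0 yE).
      by apply: f_incr; rewrite xE yE.
    by apply/allP => u /TpP[].
  - exact: leaves_sorted.
  - move=> v; apply/mapP/idP => [[u /TpP umin ->]|/TmP vmin].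
      apply/TmP/(minimal_affine_word fK gK _ umin)/imageP.
      by case: umin.
    have [/asboolP[u gu] _] := vmin.
    have umin : minimal (affine_word f) u by exact: (minimal_affine_word gK fK gu vmin).
    exists u; first exact/TpP.
    apply: (maps_word_inj (maps_word_inv gK gu)).
    by apply: imageP; case: umin.
have sizeE : size (leaves Tp) = size (leaves Tm) by rewrite -leavesE size_map.
pose E := TreePair sizeE.
have leafP i : (i < nleaves E)%N -> minimal (affine_word f) (leaf_addr Tp i).
  by move=> iE; apply/TpP/mem_nth.
have fE i : (i < nleaves E)%N -> maps_word f (leaf_addr Tp i) (leaf_addr Tm i).
  move=> iE; rewrite {2}/leaf_addr -leavesE (nth_map [::]) //.
  by apply: imageP; case: (leafP _ iE).
exists E; split=> //.
- split; last by move=> i iE; apply: maps_word_linearly_onto; exact: fE.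
  move=> i iE [[w [w0 w1]] [w' [w'0 w'1]]].
  have fw : maps_word f w w'.
    apply: maps_word_glue => -[]; rewrite -?w1 -?w0 -?w'1 -?w'0; apply: fE => //.
    exact: ltnW.
  have [_ wmin] := leafP _ (ltnW iE).
  have w_affine : affine_word f w by apply/asboolP; exists w'.
  by have := wmin w [:: false]; rewrite cats1 => /(_ w0 w_affine).
- by move=> u /cut_tree_inner/asboolP.
- by move=> u /cut_tree_inner/asboolP.
Qed.

(** * The core *)

(** Folding two cells along their bottom edges only says that the words of their
    top edges are related after one more letter; the closure of [rho] under this
    step is to be related after all long enough extensions. *)
Definition ultimately (rho : seq bool -> seq bool -> Prop) u v : Prop :=
  exists k, forall w, (k <= size w)%N -> rho (u ++ w) (v ++ w).

Section Ultimately.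
Variable rho : seq bool -> seq bool -> Prop.
Hypothesis rhoP : congruence rho.
Implicit Types u v w : seq bool.

Lemma ultimately_refl u : ultimately rho u u.
Proof. by exists 0%N => w _; exact: (cong_refl rhoP). Qed.

Lemma ultimately_sym u v : ultimately rho u v -> ultimately rho v u.
Proof. by move=> [k kP]; exists k => w /kP; exact: (cong_sym rhoP). Qed.

Lemma ultimately_trans u v w :
  ultimately rho u v -> ultimately rho v w -> ultimately rho u w.
Proof.
move=> [k kP] [l lP]; exists (maxn k l) => x; rewrite geq_max => /andP[kx lx].
exact: (cong_trans rhoP) (kP _ kx) (lP _ lx).
Qed.

Lemma ultimately_sub u v : rho u v -> ultimately rho u v.
Proof. by move=> uv; exists 0%N => w _; exact: (cong_cat rhoP). Qed.

Lemma ultimately_rcons u v b :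
  ultimately rho u v -> ultimately rho (rcons u b) (rcons v b).
Proof.
by move=> [k kP]; exists k => w kw; rewrite !cat_rcons; apply: kP; exact: leqW.
Qed.

Lemma ultimately_glue u v :
  (forall b, ultimately rho (rcons u b) (rcons v b)) -> ultimately rho u v.
Proof.
move=> uv; have [[k kP] [l lP]] := (uv false, uv true).
exists (maxn k l).+1 => -[|b w] //=; rewrite ltnS geq_max => /andP[kw lw].
by rewrite -!cat_rcons; case: b; [exact: lP|exact: kP].
Qed.

Lemma leafwise_word_local (R : realType) (f : I01 R -> I01 R) E :
  thompsonF f -> reduced_pair_of f E ->
  (forall i, (i < nleaves E)%N ->
     ultimately rho (leaf_addr (tplus E) i) (leaf_addr (tminus E) i)) ->
  word_local rho f.
Proof.
move=> [_ f_incr _] [_ fE] evE; have [k kP] := leaf_prefix (tplus E).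
have [l lP] : exists l, forall m, (l <= m)%N -> forall i, (i < nleaves E)%N ->
    forall w, (m <= size (leaf_addr (tplus E) i ++ w))%N ->
    rho (leaf_addr (tplus E) i ++ w) (leaf_addr (tminus E) i ++ w).
  apply: finite_eventually => i iE; have [n nP] := evE _ iE.
  exists (size (leaf_addr (tplus E) i) + n)%N => m nm w mw; apply: nP.
  by have := leq_trans nm mw; rewrite size_cat leq_add2l.
exists (maxn k l) => u; rewrite geq_max => /andP[ku lu].
have [i [w [iE uE]]] := kP _ ku.
exists (leaf_addr (tminus E) i ++ w).
  by rewrite uE; apply/maps_word_cat/maps_linearly_onto_word => //; exact: fE.
by rewrite uE; apply: (lP _ (leqnn _) _ iE); rewrite -uE.
Qed.

End Ultimately.

Section CoreReading.
Variables (I : Type) (D : I -> tree_pair).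

Lemma core_triangular : triangular (core D).
Proof.
apply/folded_triangular/disjoint_union_triangular => i; exact: diagram_triangular.
Qed.

Lemma core_accepts_diagram i : core_accepts D (D i).
Proof.
exists (comp_map (fold_map (@end_glue I D))
          (union_map (fun i => diagram (core_pair D i)) (Some i))).
split; apply/clsP/rst_step/fold_edge_base.
  exact: (end_glue_top _ (Some i)).
exact: (end_glue_bot _ (Some i)).
Qed.

Section FoldCongruence.
Variable rho : seq bool -> seq bool -> Prop.
Hypothesis rhoP : congruence rho.
Hypothesis leaf_rho : forall i j, (j < nleaves (D i))%N ->
  rho (leaf_addr (tplus (D i)) j) (leaf_addr (tminus (D i)) j).

(** The address in its tree of an edge of one of the diagrams; it depends on the
    chosen representative for a leaf. *)
Definition rep_word (e : edge (unfolded D)) : seq bool :=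
  edge_word (rep (projT2 e)).

Lemma rep_word_cls i (x : tp_edge (core_pair D i)) :
  ultimately rho (edge_word x) (rep_word (existT _ i (cls (@leaf_glue _) x))).
Proof.
rewrite /rep_word /=; have /esym/clsP := repK (cls (@leaf_glue _) x).
elim=> {x} [_ _ [u v j jD /= -> ->]|x|x y _|x y z _ + _].
- apply: (ultimately_sub rhoP); case: i u v jD => [i|] u v jD; first exact: leaf_rho.
  by case: j jD => // _; exact: (cong_refl rhoP).
- exact: (ultimately_refl rhoP).
- exact: (ultimately_sym rhoP).
- exact: (ultimately_trans rhoP).
Qed.

Lemma rep_word_bot b (c : cell (unfolded D)) :
  ultimately rho (rep_word (bot b c)) (rcons (rep_word (top c)) b).
Proof.
case: c => i c.
have botE : bot b (existT _ i c : cell (unfolded D))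
    = existT _ i (cls (@leaf_glue _) (tp_bot b c)) by case: b.
apply: (ultimately_trans rhoP) (ultimately_rcons b (rep_word_cls (tp_top c))).
rewrite -edge_word_bot botE; apply: (ultimately_sym rhoP); exact: rep_word_cls.
Qed.

(** The relation [ultimately rho] contains the identifications of leaves and of
    ends, and it is closed under every folding since it passes from a word to its
    two children and back. *)
Lemma fold_edge_ultimately e e' : fold_edge (@end_glue I D) e e' ->
  ultimately rho (rep_word e) (rep_word e').
Proof.
have bot_top b c c' : ultimately rho (rep_word (top c)) (rep_word (top c')) ->
    ultimately rho (rep_word (bot b c)) (rep_word (bot b c')).
  move=> cc'; apply: (ultimately_trans rhoP (rep_word_bot b c)).
  apply: (ultimately_trans rhoP (ultimately_rcons b cc')).
  exact/(ultimately_sym rhoP)/rep_word_bot.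
have root_word i : ultimately rho (rep_word (existT _ i (top_edge (core_pair D i)))) [::]
    /\ ultimately rho (rep_word (existT _ i (bot_edge (core_pair D i)))) [::].
  split; apply: (ultimately_sym rhoP).
    exact: (rep_word_cls (inl (Defs.root (tplus (core_pair D i))))).
  exact: (rep_word_cls (inr (Defs.root (tminus (core_pair D i))))).
elim=> {e e'}.
- move=> _ _ [] i; apply: (ultimately_trans rhoP (v := [::])).
  + exact: (root_word i).1.
  + exact/(ultimately_sym rhoP)/(root_word None).1.
  + exact: (root_word i).2.
  + exact/(ultimately_sym rhoP)/(root_word None).1.
- by move=> e; exact: (ultimately_refl rhoP).
- by move=> e e' _; exact: (ultimately_sym rhoP).
- by move=> e e' e'' _ + _; exact: (ultimately_trans rhoP).
- by move=> c c' _; exact: (bot_top false).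
- by move=> c c' _; exact: (bot_top true).
- move=> c c' _ l _ r; apply: (ultimately_glue (rho := rho)) => b.
  apply: (ultimately_trans rhoP) (rep_word_bot b c').
  apply: (ultimately_trans rhoP (ultimately_sym rhoP (rep_word_bot b c))).
  by case: b.
Qed.

Lemma core_accepts_ultimately E : core_accepts D E ->
  forall i, (i < nleaves E)%N ->
    ultimately rho (leaf_addr (tplus E) i) (leaf_addr (tminus E) i).
Proof.
move=> [phi [phi_top phi_bot]].
have clsE e e' : cls (fold_edge (@end_glue I D)) e = cls (fold_edge (@end_glue I D)) e' ->
    ultimately rho (rep_word e) (rep_word e').
  by move=> /clsP/clos_fold_edge; exact: fold_edge_ultimately.
have rep_root : ultimately rho [::] (rep_word (p0 D)).
  exact: (rep_word_cls (i := None) (inl (Defs.root Leaf))).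
have wordE (x : tp_edge E) e :
    emap phi (cls (@leaf_glue E) x) = cls (fold_edge (@end_glue I D)) e ->
    ultimately rho (edge_word x) (rep_word e).
  elim/tp_edge_ind: x e => [||b c IH] e.
  - by move=> /(etrans (esym phi_top))/clsE; exact: (ultimately_trans rhoP).
  - by move=> /(etrans (esym phi_bot))/clsE; exact: (ultimately_trans rhoP).
  - pose d : cell (unfolded D) := rep (cmap phi c).
    have topE : emap phi (cls (@leaf_glue E) (tp_top c)) = cls _ (top d).
      by rewrite -[LHS](map_top phi).
    have botE : bot b (cmap phi c) = cls (fold_edge (@end_glue I D)) (bot b d).
      by case: (b).
    rewrite -(map_bot phi) botE => /clsE de; rewrite edge_word_bot.
    apply: (ultimately_trans rhoP) de.
    apply: (ultimately_trans rhoP (ultimately_rcons b (IH _ topE))).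
    exact/(ultimately_sym rhoP)/rep_word_bot.
move=> i /cls_leaf[x [y [<- <- xy]]].
apply: (ultimately_trans rhoP (v := rep_word (rep (emap phi (cls (@leaf_glue E) x))))).
  by apply: wordE; rewrite repK.
by apply/(ultimately_sym rhoP)/wordE; rewrite repK xy.
Qed.

End FoldCongruence.

End CoreReading.

(** * The closure *)

Theorem theorem1p1 (R : realType) (H : set (I01 R -> I01 R))
    (I : Type) (g : I -> I01 R -> I01 R) (D : I -> tree_pair)
    (H_le_F : subgroupF H)
    (g_in_F : forall i, thompsonF (g i))
    (g_generate : H = smallest (@subgroupF R) (range g))
    (g_diagram : forall i, reduced_pair_of (g i) (D i)) :
  subgroupF (closure_of D R) /\
  closure_of D R = [set f | thompsonF f /\
    exists2 s, dyadic_partition s &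
      forall i, (i < size s)%N ->
        (exists a b : R, affine_on (piece s i) f a b) /\
        exists2 h, H h & forall x : I01 R, piece s i (pt x) -> f x = h x].
Proof.
have HP := maps_by_congruence H_le_F.
have -> : [set f | thompsonF f /\ exists2 s, dyadic_partition s &
      forall i, (i < size s)%N ->
        (exists a b : R, affine_on (piece s i) f a b) /\
        exists2 h, H h & forall x : I01 R, piece s i (pt x) -> f x = h x]
    = word_localF (maps_by H).
  by apply/seteqP; split=> f [fF fP]; split=> //; apply/piecewise_word_local.
suff -> : closure_of D R = word_localF (maps_by H).
  by split=> //; exact: word_localF_subgroup.
have g_leaf i j : (j < nleaves (D i))%N ->
    maps_by H (leaf_addr (tplus (D i)) j) (leaf_addr (tminus (D i)) j).
  move=> jD; exists (g i).
    by rewrite g_generate; apply: sub_gen_smallest; exists i.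
  have [_ g_incr _] := g_in_F i.
  by apply: maps_linearly_onto_word => //; case: (g_diagram i) => _; exact.
pose reads u v := read (core_p D) u = read (core_p D) v.
have top_inj := @folded_top_inj _ (@end_glue I D).
have bot_inj := @folded_bot_inj _ (@end_glue I D).
have readsP : congruence reads by exact: read_congruence.
have H_reads : H `<=` word_localF reads.
  rewrite g_generate; apply: smallest_sub; first exact: word_localF_subgroup.
  move=> _ [i _ <-]; split; first exact: g_in_F.
  apply: (leafwise_word_local (g_in_F i) (g_diagram i)) => j jD.
  apply: (ultimately_sub readsP); apply: (accepts_read top_inj) jD.
  exact: core_accepts_diagram.
apply/seteqP; split=> f [fF].
  move=> [E fE fD]; split=> //; apply: (leafwise_word_local fF fE).
  exact: (core_accepts_ultimately HP g_leaf).
move=> [k fH]; split=> //.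
have f_reads : word_local reads f.
  exists k => u /fH[v fv [h Hh hv]]; exists v => //.
  by have [_ h_reads] := H_reads _ Hh; exact: (maps_word_read top_inj bot_inj h_reads).
have [[f' [fK f'K _ _]] f_incr _] := fF.
have f'_reads : word_local reads f' by exact: word_local_inv f_reads.
have forget (h : I01 R -> I01 R) : word_local reads h -> word_local (fun _ _ => True) h.
  by move=> [l lP]; exists l => u /lP[v]; exists v.
have [E [fE innerP innerM leafE]] :=
  minimal_pair f_incr fK f'K (forget _ f_reads) (forget _ f'_reads).
exists E => //; apply: read_accepts => [||u /innerP u_in|u /innerM u_in|i iE].
- exact: top_inj.
- exact: core_triangular.
- by apply: contrapT => /(dead_maps_word top_inj bot_inj f_reads).
- by apply: contrapT => /(dead_maps_word top_inj bot_inj f'_reads).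
- exact: (maps_word_read top_inj bot_inj f_reads (leafE _ iE)).
Qed.
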